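(* Let $a,b\in\mathbb{Q}$ be fixed. The linking number polynomials, which assign to an oriented virtual tangle $T$ with ordered components $T_1,\ldots,T_n$ $$p_{lk}(T)=p_{sc}(T)+\sum_{i<j}\bigl[a\cdot vlk(T_i,T_j)+b\cdot vlk(T_j,T_i)\bigr]t_it_j,$$ $$p_{lk,L}(T)=p_{sc}(T)+\sum_{i<j}\Bigl(a\cdot vlk(T_i,T_j)\,t_it_j^{-1}+b\cdot vlk(T_j,T_i)\,t_i^{-1}t_j\Bigr),$$ are order one Vassiliev invariants of virtual tangles.
   Context: **Virtual tangles.** A virtual tangle diagram is a generic immersion in a square of finitely many circles (closed components) and intervals (long components); the endpoints of the long components are fixed distinguished points on the top or bottom side of the square. Each transverse double point of the immersion is marked either as a classical crossing (with over/under information) or as a virtual crossing. Long components need not connect top to bottom, and the numbers of endpoints at top and bottom may differ. A virtual tangle is an equivalence class of such diagrams under planar isotopy (fixing endpoints), the classical Reidemeister moves 1, 2, 3 (on classical crossings), and the virtual Reidemeister moves: the analogues of moves 1, 2, 3 with all crossings virtual, and the mixed move in which a strand having only virtual crossings passes over/past a classical crossing. A virtual tangle is oriented if every component is oriented. The components are ordered $T_1,\ldots,T_n$, and the $i$-th component is assigned a variable $t_i$. **Sign.** The sign $\mathrm{sgn}(c)=\pm1$ of a classical crossing $c$ of oriented strands is $+1$ if (direction of over-strand, direction of under-strand) is a positively oriented basis of the plane, and $-1$ otherwise. **Intersection index.** Let $c$ be a classical self-crossing of a component $T_i$. Smooth $c$ according to orientation; $T_i$ is replaced by two oriented components $L_1,L_2$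 (ordered arbitrarily). Forget the over/under information at the remaining classical crossings (pass to the flat diagram); virtual crossings remain virtual. To each flat (non-virtual) crossing $x$ between $L_1$ and $L_2$ assign the sign $\mathrm{sgn}(x)$ it would have as a classical crossing with $L_1$ over $L_2$. Then $i(c)=\sum_{x\in L_1\cap L_2}\mathrm{sgn}(x)$, ignoring crossings that involve components of the tangle other than $L_1,L_2$. Exchanging $L_1$ and $L_2$ changes $i(c)$ by a sign, so $|i(c)|$ is well defined. **Self-crossing polynomial.** $p_{sc}(T)=\sum_{i=1}^n\sum_{c\in T_i}\mathrm{sgn}(c)(t_i^{|i(c)|}-1)\in\mathbb{Z}[t_1,\ldots,t_n]$, the inner sum being over classical self-crossings $c$ of $T_i$. **Virtual linking number.** For distinct components $T_i,T_j$, $vlk(T_i,T_j)=\sum \mathrm{sgn}(d)$, summed over the classical crossings $d$ at which $T_i$ passes over $T_j$. **Vassiliev invariants.** A singular virtual tangle is a virtual tangle whose diagrams may have an additional type of crossing, transverse double points, considered modulo the moves above and rigid vertex isotopy. A virtual tangle invariant $\nu$ is extended to singular virtual tangles by resolving each double point as $\nu(\text{double point})=\nu(\text{positive crossing})-\nu(\text{negative crossing})$. The invariant $\nu$ is a Vassiliev (finite-type) invariant of order $\leq n$ if its extension vanishes on every singular virtual tangle with more than $n$ double points; it is of order $n$ if it is of order $\leq n$ but not of order $\leq n-1$. *)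

(* Defs.v *)
From HB Require Import structures.
From mathcomp Require Import all_boot all_order all_algebra fraction.
From mathcomp Require Import all_classical all_reals.
From mathcomp Require Import topology normedtype derive.
(* mpoly's notations clash with those of mathcomp-analysis. *)
From mathcomp Require Import -(notations) mpoly.
From Stdlib Require Import Relation_Operators.
From Stdlib Require List.

Set Implicit Arguments.
Unset Strict Implicit.
Unset Printing Implicit Defensive.

Import Order.TTheory GRing.Theory Num.Theory numFieldNormedType.Exports.
Local Open Scope ring_scope.

Definition plane (R : realType) : Type := (R * R)%type.

Definition det (R : realType) (u v : plane R) : R := u.1 * v.2 - u.2 * v.1.

Definition velocity (R : realType) (g : R -> plane R) (t : R) : plane R :=
  (derive1 (fun s => (g s).1) t, derive1 (fun s => (g s).2) t).

Definition C1 (R : realType) (g : R -> plane R) : Prop :=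
  (forall t, derivable (fun s => (g s).1) t 1 /\
             derivable (fun s => (g s).2) t 1)
  /\ continuous (velocity g : R -> R * R).

(* The tangles live in the unit square. *)
Definition in_open_square (R : realType) (z : plane R) : bool :=
  (0 < z.1 < 1) && (0 < z.2 < 1).

Definition on_top_or_bottom (R : realType) (z : plane R) : bool :=
  (0 <= z.1 <= 1) && ((z.2 == 0) || (z.2 == 1)).

Inductive kind := Classical | Virtual | Singular.

Lemma kind_comparable : comparable kind.
Proof. by rewrite /comparable /decidable => x y; decide equality. Qed.

HB.instance Definition _ := hasDecEq.Build kind (compareP kind_comparable).

Definition point (R : realType) (n : nat) : Type := ('I_n * R)%type.

(* A double point of the immersion, as the pair of its preimages, with its
   marking.  At a classical crossing the first strand passes over the second;
   at a virtual crossing or a singular double point the order of the two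
   preimages carries no information (see [listed]). *)
Definition crossing (R : realType) (n : nat) : Type :=
  (point R n * point R n * kind)%type.

Definition over (R : realType) (n : nat) (c : crossing R n) : point R n :=
  c.1.1.
Definition under (R : realType) (n : nat) (c : crossing R n) : point R n :=
  c.1.2.
Definition flip (R : realType) (n : nat) (c : crossing R n) : crossing R n :=
  (under c, over c, c.2).

(* A closed component is a 1-periodic curve, parametrized by [0, 1[; a long
   component is the restriction of a curve to [0, 1].  The parametrization
   orients the component. *)
Record diagram (R : realType) (n : nat) := Diagram {
  closed : {set 'I_n};
  curve : 'I_n -> R -> plane R;
  crossings : seq (crossing R n)
}.

Definition image (R : realType) (n : nat) (D : diagram R n) (p : point R n) :
  plane R := curve D p.1 p.2.

Definition tangent (R : realType) (n : nat) (D : diagram R n) (p : point R n) :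
  plane R := velocity (curve D p.1) p.2.

Definition in_domain (R : realType) (n : nat) (D : diagram R n)
    (p : point R n) : bool :=
  if p.1 \in closed D then 0 <= p.2 < 1 else 0 <= p.2 <= 1.

Definition in_interior (R : realType) (n : nat) (D : diagram R n)
    (p : point R n) : bool :=
  if p.1 \in closed D then 0 <= p.2 < 1 else 0 < p.2 < 1.

(* Generic immersion in the square, with [crossings D] enumerating exactly its
   double points; [generic_uniq] excludes triple points and repetitions. *)
Record generic (R : realType) (n : nat) (D : diagram R n) : Prop := Generic {
  generic_C1 : forall i, C1 (curve D i);
  generic_immersed : forall p, in_domain D p -> tangent D p <> (0, 0);
  generic_periodic :
    forall i t, i \in closed D -> curve D i (t + 1) = curve D i t;
  generic_interior : forall p, in_interior D p -> in_open_square (image D p);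
  generic_ends : forall i, i \notin closed D ->
    on_top_or_bottom (curve D i 0) /\ on_top_or_bottom (curve D i 1);
  generic_sound : forall c, c \in crossings D ->
    [/\ in_interior D (over c), in_interior D (under c),
        image D (over c) = image D (under c) &
        det (tangent D (over c)) (tangent D (under c)) <> 0];
  generic_complete : forall p q, in_domain D p -> in_domain D q -> p <> q ->
    image D p = image D q ->
    exists2 c, c \in crossings D &
      (over c = p /\ under c = q) \/ (over c = q /\ under c = p);
  generic_uniq : uniq (map (@over R n) (crossings D) ++
                       map (@under R n) (crossings D))
}.

Definition double_point_count (R : realType) (n : nat) (D : diagram R n) : nat :=
  count (fun c => c.2 == Singular) (crossings D).

Definition listed (R : realType) (n : nat) (s : seq (crossing R n))
    (c : crossing R n) : bool :=
  (c \in s) || ((c.2 != Classical) && (flip c \in s)).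

(* Two enumerations of the crossings of the same marked immersion. *)
Definition same_diagram (R : realType) (n : nat) (D D' : diagram R n) : Prop :=
  [/\ generic D, generic D', closed D = closed D', curve D = curve D' &
      forall c, listed (crossings D) c = listed (crossings D') c].

(* Moving crossings: two preimages moving continuously, with a constant
   marking.  On a closed component the motion is a real lift of a motion on
   the circle, brought back to [0, 1[ by [normalize]. *)
Definition moving_point (R : realType) (n : nat) : Type :=
  ('I_n * (R -> R))%type.
Definition moving_crossing (R : realType) (n : nat) : Type :=
  (moving_point R n * moving_point R n * kind)%type.

Definition normalize (R : realType) (n : nat) (cl : {set 'I_n})
    (p : point R n) : point R n :=
  (p.1, if p.1 \in cl then p.2 - (Num.floor p.2)%:~R else p.2).

Definition crossing_at (R : realType) (n : nat) (cl : {set 'I_n}) (s : R)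
    (c : moving_crossing R n) : crossing R n :=
  (normalize cl (c.1.1.1, c.1.1.2 s), normalize cl (c.1.2.1, c.1.2.2 s), c.2).

(* A path s |-> D_s of generic diagrams, 0 <= s <= 1, jointly C^1 in the curve
   parameter, along which the crossings move continuously and the endpoints of
   the long components are fixed.  Reparametrizations preserving orientation,
   including changes of the base point of a closed component, are of this
   form. *)
Definition planar_isotopy (R : realType) (n : nat) (D D' : diagram R n) :
    Prop :=
  exists (g : R -> 'I_n -> R -> plane R) (xs : seq (moving_crossing R n)),
  let Ds s := Diagram (closed D) (g s) (map (crossing_at (closed D) s) xs) in
  [/\ (forall i, continuous ((fun z => g z.1 i z.2) : R * R -> R * R)) /\
      (forall i, continuous
         ((fun z => velocity (g z.1 i) z.2) : R * R -> R * R)),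
      forall c, List.In c xs -> continuous c.1.1.2 /\ continuous c.1.2.2,
      forall s, 0 <= s <= 1 -> generic (Ds s),
      forall s i, 0 <= s <= 1 -> i \notin closed D ->
        g s i 0 = g 0 i 0 /\ g s i 1 = g 0 i 1 &
      D = Ds 0 /\ D' = Ds 1].

(* The part of component [scomp] with parameters [smid + shalf * u],
   -1 <= u <= 1; a negative [shalf] means that u runs against the
   orientation. *)
Record strand (R : realType) (n : nat) := Strand {
  scomp : 'I_n; smid : R; shalf : R
}.

Definition at_strand (R : realType) (n : nat) (S : strand R n) (u : R) :
  point R n := (scomp S, smid S + shalf S * u).

Definition on_strand (R : realType) (n : nat) (S : strand R n)
    (p : point R n) : bool :=
  (p.1 == scomp S) && (`|p.2 - smid S| <= `|shalf S|).

Definition wf_strand (R : realType) (n : nat) (S : strand R n) : bool :=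
  [&& shalf S != 0, 0 < smid S - `|shalf S| & smid S + `|shalf S| < 1].

Definition disjoint_strands (R : realType) (n : nat) (S T : strand R n) :
    bool :=
  (scomp S != scomp T) || (`|shalf S| + `|shalf T| < `|smid S - smid T|).

(* The square disc with centre o and half-side r. *)
Definition in_disc (R : realType) (o : plane R) (r : R) (z : plane R) : bool :=
  (`|z.1 - o.1| <= r) && (`|z.2 - o.2| <= r).

(* S is drawn as the model curve m, which lives in [-1, 1] x [-1, 1], suitably
   scaled and translated. *)
Definition drawn_as (R : realType) (n : nat) (D : diagram R n) (o : plane R)
    (r : R) (S : strand R n) (m : R -> plane R) : Prop :=
  forall u, -1 <= u <= 1 ->
    image D (at_strand S u) = (o.1 + r * (m u).1, o.2 + r * (m u).2).

(* D' is obtained from D by redrawing, inside a disc which meets D only in the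
   listed strands, each strand [w.1.1] from the model [w.1.2] to the model
   [w.2]; the crossings inside the disc are X for D and X' for D'.  Since the
   disc can be brought into standard position by a planar isotopy, axis-parallel
   square discs and fixed model curves are enough. *)
Definition local_move (R : realType) (n : nat) (D D' : diagram R n)
    (W : seq (strand R n * (R -> plane R) * (R -> plane R)))
    (X X' : seq (crossing R n)) : Prop :=
  let inside p := has (fun w => on_strand w.1.1 p) W in
  [/\ generic D, generic D' & closed D = closed D'] /\
  exists (o : plane R) (r : R) (rest : seq (crossing R n)),
  [/\ 0 < r /\ (forall z, in_disc o r z -> in_open_square z),
      all (fun w => wf_strand w.1.1) W &&
        pairwise (fun w w' => disjoint_strands w.1.1 w'.1.1) W,
      forall w, List.In w W ->
        drawn_as D o r w.1.1 w.1.2 /\ drawn_as D' o r w.1.1 w.2,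
      forall p, in_domain D p -> ~~ inside p ->
        image D p = image D' p /\ ~~ in_disc o r (image D p) &
      [/\ crossings D = X ++ rest, crossings D' = X' ++ rest &
          forall c, c \in rest -> ~~ inside (over c) /\ ~~ inside (under c)]].

Definition mk_crossing (R : realType) (n : nat) (b : bool) (p q : point R n)
    (k : kind) : crossing R n :=
  if b then (p, q, k) else (q, p, k).

(* Model curves; both curves of a pair agree to first order at u = -1 and
   u = 1.  [curl] crosses itself once, at u = -1/2 and u = 1/2. *)
Definition curl (R : realType) (u : R) : plane R :=
  (u * (4 * u ^+ 2 - 1) * (7 - 4 * u ^+ 2) / 9, (1 - u ^+ 2) ^+ 2 / 2).

Definition horizontal (R : realType) (h : R) (u : R) : plane R := (u, h).

(* [dip] crosses [horizontal 0] at u = -1/2 and u = 1/2, and agrees to first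
   order with [horizontal (9 / 16)] at its ends. *)
Definition dip (R : realType) (u : R) : plane R :=
  (u, 9 / 16 - (1 - u ^+ 2) ^+ 2).

(* [rising_left e] and [rising_right e], for e = 1 and e = -1, run upwards;
   those with e = 1 and e = -1 are mirror images in the axis x = 0.
   They cross each other at height 1/2 for [rising_left] and at height -1/2
   for [rising_right], and cross [horizontal 0] at x = - e * 4/9, resp. at
   x = e * 4/9. *)
Definition rising_left (R : realType) (e u : R) : plane R :=
  (e * (u / 2 - 4 / 9 * (1 - u ^+ 2) ^+ 2), u).
Definition rising_right (R : realType) (e u : R) : plane R :=
  (e * (u / 2 + 4 / 9 * (1 - u ^+ 2) ^+ 2), u).

Definition reidemeister1 (R : realType) (n : nat) (D D' : diagram R n) : Prop :=
  exists (S : strand R n) (b : bool) (k : kind), k <> Singular /\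
  local_move D D' [:: (S, @curl R, horizontal 0)]
    [:: mk_crossing b (at_strand S (- (1 / 2))) (at_strand S (1 / 2)) k] [::].

Definition reidemeister2 (R : realType) (n : nat) (D D' : diagram R n) : Prop :=
  exists (A B : strand R n) (b : bool) (k : kind), k <> Singular /\
  local_move D D'
    [:: (A, horizontal 0, horizontal 0); (B, @dip R, horizontal (9 / 16))]
    [:: mk_crossing b (at_strand A (- (1 / 2))) (at_strand B (- (1 / 2))) k;
        mk_crossing b (at_strand A (1 / 2)) (at_strand B (1 / 2)) k]
    [::].

(* The strand C passes over (b = true) or under (b = false) a crossing of
   A and B which is classical or singular, or passes with virtual crossings
   over a crossing of A and B of any kind.  This is the classical and virtual
   move 3, the mixed move, and the rigid vertex isotopies moving a strand past a
   double point.  The forbidden moves (C classical, A and B virtual) are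
   excluded. *)
Definition reidemeister3 (R : realType) (n : nat) (D D' : diagram R n) : Prop :=
  exists (A B C : strand R n) (b bAB : bool) (k kAB : kind),
  [/\ k <> Singular, k = Classical -> kAB <> Virtual &
  local_move D D'
    [:: (A, rising_left 1, rising_right 1);
        (B, rising_left (-1), rising_right (-1));
        (C, horizontal 0, horizontal 0)]
    [:: mk_crossing bAB (at_strand A (1 / 2)) (at_strand B (1 / 2)) kAB;
        mk_crossing b (at_strand C (- (4 / 9))) (at_strand A 0) k;
        mk_crossing b (at_strand C (4 / 9)) (at_strand B 0) k]
    [:: mk_crossing bAB (at_strand A (- (1 / 2))) (at_strand B (- (1 / 2))) kAB;
        mk_crossing b (at_strand C (4 / 9)) (at_strand A 0) k;
        mk_crossing b (at_strand C (- (4 / 9))) (at_strand B 0) k]].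

(* Half a turn of a rigid vertex about the horizontal axis: the double point
   and a classical crossing of two twisted strands are exchanged. *)
Definition vertex_twist (R : realType) (n : nat) (D D' : diagram R n) : Prop :=
  exists (A B : strand R n) (b : bool),
  local_move D D'
    [:: (A, horizontal 0, horizontal 0); (B, @dip R, @dip R)]
    [:: mk_crossing b (at_strand A (- (1 / 2))) (at_strand B (- (1 / 2)))
          Classical;
        mk_crossing true (at_strand A (1 / 2)) (at_strand B (1 / 2)) Singular]
    [:: mk_crossing true (at_strand A (- (1 / 2))) (at_strand B (- (1 / 2)))
          Singular;
        mk_crossing (~~ b) (at_strand A (1 / 2)) (at_strand B (1 / 2))
          Classical].

Definition tangle_step (R : realType) (n : nat) (D D' : diagram R n) : Prop :=
  [\/ same_diagram D D', planar_isotopy D D' |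
   [\/ reidemeister1 D D', reidemeister2 D D', reidemeister3 D D' |
       vertex_twist D D']].

(* Singular virtual tangles (oriented, with ordered components) are the classes
   of generic diagrams under this equivalence; virtual tangles are the classes
   of generic diagrams without singular double points, a condition which all
   the moves preserve. *)
Definition tangle_equiv (R : realType) (n : nat) :
    diagram R n -> diagram R n -> Prop :=
  clos_refl_sym_trans _ (@tangle_step R n).

Section Vassiliev.
Context (R : realType) (V : nat -> zmodType)
        (nu : forall n : nat, diagram R n -> V n).

Definition tangle_invariant : Prop :=
  forall (n : nat) (D D' : diagram R n), generic D -> generic D' ->
    double_point_count D = 0%N -> double_point_count D' = 0%N ->
    tangle_equiv D D' -> nu D = nu D'.

Definition positive_resolution (n : nat) (D : diagram R n)
    (c : crossing R n) : crossing R n :=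
  mk_crossing (0 < det (tangent D (over c)) (tangent D (under c)))
    (over c) (under c) Classical.

Definition negative_resolution (n : nat) (D : diagram R n)
    (c : crossing R n) : crossing R n :=
  flip (positive_resolution D c).

(* nu (double point) = nu (positive crossing) - nu (negative crossing), applied
   to each singular crossing in turn; [done] lists the crossings already
   treated. *)
Fixpoint resolve (n : nat) (D : diagram R n) (done todo : seq (crossing R n)) :
    V n :=
  match todo with
  | [::] => nu (Diagram (closed D) (curve D) done)
  | c :: s =>
      if c.2 == Singular then
        resolve D (rcons done (positive_resolution D c)) s
        - resolve D (rcons done (negative_resolution D c)) s
      else resolve D (rcons done c) s
  end.

Definition singular_extension (n : nat) (D : diagram R n) : V n :=
  resolve D [::] (crossings D).

Definition vassiliev_order_le (m : nat) : Prop :=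
  tangle_invariant /\
  forall (n : nat) (D : diagram R n), generic D -> (m < double_point_count D)%N ->
    singular_extension D = 0.

Definition vassiliev_order (m : nat) : Prop :=
  vassiliev_order_le m /\ forall m', (m' < m)%N -> ~ vassiliev_order_le m'.

End Vassiliev.

Definition sign_at (R : realType) (n : nat) (D : diagram R n) (p q : point R n) :
  int := sgz (det (tangent D p) (tangent D q)).

Definition sgn (R : realType) (n : nat) (D : diagram R n) (c : crossing R n) :
  int := sign_at D (over c) (under c).

Definition self_crossing (R : realType) (n : nat) (i : 'I_n)
    (c : crossing R n) : bool :=
  [&& c.2 == Classical, (over c).1 == i & (under c).1 == i].

(* The oriented smoothing of a self-crossing c with preimages s < t replaces the
   component by the closed curve run through by ]s, t[ and by the curve run
   through by the other parameters, from the beginning to s and from t on. *)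
Definition in_L1 (R : realType) (n : nat) (c : crossing R n) (p : point R n) :
    bool :=
  (p.1 == (over c).1) &&
  (Num.min (over c).2 (under c).2 < p.2 < Num.max (over c).2 (under c).2).

Definition in_L2 (R : realType) (n : nat) (c : crossing R n) (p : point R n) :
    bool :=
  (p.1 == (over c).1) &&
  ((p.2 < Num.min (over c).2 (under c).2) ||
   (Num.max (over c).2 (under c).2 < p.2)).

Definition intersection_index (R : realType) (n : nat) (D : diagram R n)
    (c : crossing R n) : int :=
  \sum_(x <- crossings D | x.2 == Classical)
    (if in_L1 c (over x) && in_L2 c (under x) then sign_at D (over x) (under x)
     else if in_L1 c (under x) && in_L2 c (over x)
     then sign_at D (under x) (over x) else 0).

Definition t_ (K : nzRingType) (n : nat) (i : 'I_n) : mpoly n K :=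
  mpolyX K (mnm1 i).

Definition p_sc (R : realType) (n : nat) (D : diagram R n) : mpoly n int :=
  \sum_(i < n) \sum_(c <- crossings D | self_crossing i c)
    (t_ int i ^+ `|intersection_index D c|%N - 1) *~ sgn D c.

Definition vlk (R : realType) (n : nat) (D : diagram R n) (i j : 'I_n) : int :=
  \sum_(c <- crossings D |
        [&& c.2 == Classical, (over c).1 == i & (under c).1 == j]) sgn D c.

Definition p_lk (R : realType) (a b : rat) (n : nat) (D : diagram R n) :
    mpoly n rat :=
  map_mpoly intr (p_sc D) +
  \sum_(i < n) \sum_(j < n | (i < j)%N)
    (a * (vlk D i j)%:~R + b * (vlk D j i)%:~R) *: (t_ rat i * t_ rat j).

(* Laurent polynomials are taken inside the field of rational functions. *)
Definition p_lkL (R : realType) (a b : rat) (n : nat) (D : diagram R n) :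
    {fraction (mpoly n rat)} :=
  let t i : {fraction (mpoly n rat)} := tofrac (t_ rat i) in
  let cst (x : rat) : {fraction (mpoly n rat)} := tofrac (mpolyC n x) in
  tofrac (map_mpoly intr (p_sc D)) +
  \sum_(i < n) \sum_(j < n | (i < j)%N)
    (cst (a * (vlk D i j)%:~R) * (t i * (t j)^-1) +
     cst (b * (vlk D j i)%:~R) * ((t i)^-1 * t j)).

(* Main.v *)
Require Import Defs.
From mathcomp Require Import all_boot all_order all_algebra fraction.
From mathcomp Require Import all_classical all_reals.
From mathcomp Require Import topology normedtype derive realfun.
From mathcomp Require Import -(notations) mpoly.
From mathcomp Require Import ring lra.
From Stdlib Require Import Relation_Operators.
From Stdlib Require List.
(* Diagrams, not topology, give their meaning to [closed] and [image]. *)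
Require Import Defs.

Set Implicit Arguments.
Unset Strict Implicit.
Unset Printing Implicit Defensive.

Import Order.TTheory GRing.Theory Num.Theory numFieldNormedType.Exports.
Local Open Scope ring_scope.

(** Both polynomials are instances of one construction, [state_sum]: every
    classical crossing c contributes sgn c times a weight, which for a
    self-crossing depends on its component and on |i(c)|, and otherwise on the
    pair of components only.  The weight of a self-crossing of index 0
    vanishes, t^0 - 1 = 0, and any state sum with this property is an invariant
    of order at most one.

    Invariance.  A self-crossing is a chord joining two parameters of its
    component.  Write h(p, q) for the sign of q - p; the chords (p, q) and
    (u, v) have the antisymmetric form
    [interlacing] = h(p, u) - h(p, v) - h(q, u) + h(q, v), which is twice their
    algebraic intersection number, and 2 |i(c)| is the absolute value of the
    sum over x of sgn x times the form of c and x ([signed_interlacing_index]).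
    The chord of a move 1 meets no other chord.  The two chords of a move 2
    have parallel positions and opposite signs: they cancel in the index of any
    third crossing, and by antisymmetry they have the same index, so that their
    own contributions cancel.  A move 3 exchanges three pairs of adjacent chord
    ends; each of the three chords sees two such exchanges, and they compensate
    because the sign of a crossing is the product of the directions of its
    strands ([triangle_interlacing]).  Along an isotopy, signs are signs of
    continuous nonvanishing determinants, and linear and cyclic orders of
    distinct moving points do not change ([sgn_moving], [interlacing_moving]).
    Singular diagrams are never met: the number of double points vanishes at
    both ends of a move or at neither.

    Order at most one.  The index does not see which strand of another crossing
    is the upper one, so it is the same in all resolutions of a singular
    diagram.  The resolved state sum is therefore a sum of terms each depending
    on one crossing alone, and its second differences vanish
    ([resolve_state_sum]).

    Order exactly one.  A double point which is a self-crossing of index 1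
    contributes twice the weight of index 1, that is 2 (t - 1).  One occurs on a
    long trefoil with one double point, one classical and one virtual crossing
    ([long_trefoil]). *)

(** * The interlacing form of chords *)

Definition order_sign (R : realType) (n : nat) (p q : point R n) : int :=
  if p.1 == q.1 then sgz (q.2 - p.2) else 0.

(** Twice the algebraic intersection number of two chords of a component.
    Being bilinear in the end points, it changes in a controlled way when
    two neighbouring ends are exchanged, which the definition by intervals
    does not show. *)
Definition interlacing (R : realType) (n : nat) (c x : crossing R n) : int :=
  order_sign (over c) (over x) - order_sign (over c) (under x)
  - order_sign (under c) (over x) + order_sign (under c) (under x).

Definition is_self (R : realType) (n : nat) (c : crossing R n) : bool :=
  (over c).1 == (under c).1.

(** The contribution of [x] to the intersection index of [c]. *)
Definition index_term (R : realType) (n : nat) (D : diagram R n)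
    (c x : crossing R n) : int :=
  if in_L1 c (over x) && in_L2 c (under x) then sign_at D (over x) (under x)
  else if in_L1 c (under x) && in_L2 c (over x)
  then sign_at D (under x) (over x) else 0.

Definition signed_interlacing (R : realType) (n : nat) (D : diagram R n)
    (s : seq (crossing R n)) (c : crossing R n) : int :=
  \sum_(x <- s | (x.2 == Classical) && is_self x) sgn D x * interlacing c x.

Section Interlacing.
Context (R : realType) (n : nat).
Implicit Types (D : diagram R n) (p q : point R n) (c x : crossing R n).

Lemma order_signC p q : order_sign q p = - order_sign p q.
Proof. by rewrite /order_sign eq_sym; case: eqP; rewrite ?oppr0// -sgzN opprB.
Qed.

Lemma order_signxx p : order_sign p p = 0.
Proof. by rewrite /order_sign eqxx subrr sgz0. Qed.

Lemma interlacingC c x : interlacing x c = - interlacing c x.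
Proof.
rewrite /interlacing (order_signC (over c)) (order_signC (over c)).
rewrite (order_signC (under c)) (order_signC (under c)); ring.
Qed.

Lemma interlacingxx c : interlacing c c = 0.
Proof.
rewrite /interlacing !order_signxx (order_signC (over c)); ring.
Qed.

Lemma det_antisym (u v : plane R) : det v u = - det u v.
Proof. by rewrite /det; ring. Qed.

Lemma sign_atC D p q : sign_at D q p = - sign_at D p q.
Proof. by rewrite /sign_at det_antisym sgzN. Qed.

Lemma sgn_flip D c : sgn D (flip c) = - sgn D c.
Proof. by rewrite /sgn sign_atC. Qed.

Lemma is_self_flip c : is_self (flip c) = is_self c.
Proof. by rewrite /is_self eq_sym. Qed.

(** This is what makes the two branches of [index_term] exclusive, hence
    the index insensitive to the order of the strands at [x]. *)
Lemma in_L12 c p : in_L1 c p -> in_L2 c p = false.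
Proof.
rewrite /in_L1 /in_L2 => /andP[-> /andP[h1 h2]] /=.
by apply/negbTE; rewrite negb_or -!leNgt !ltW.
Qed.

Lemma index_term_flip D c x : index_term D c (flip x) = index_term D c x.
Proof.
rewrite /index_term /flip /over /under /=.
case: ifP => [/andP[a1 a2]|_]; last by case: ifP.
by rewrite (in_L12 a1) andbF.
Qed.

Lemma index_termxx D c : index_term D c c = 0.
Proof.
have L1 p : p = over c \/ p = under c -> in_L1 c p = false.
  move=> pc; rewrite /in_L1 gt_min lt_max; case: pc => ->; rewrite ltxx andbC.
    by case: ltgtP.
  by case: ltgtP.
by rewrite /index_term !L1; [|by right|by left].
Qed.

Lemma in_L1_flip c p : is_self c -> in_L1 (flip c) p = in_L1 c p.
Proof.
by move=> /eqP e; rewrite /in_L1 /flip /over /under /= -e minC maxC.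
Qed.

Lemma in_L2_flip c p : is_self c -> in_L2 (flip c) p = in_L2 c p.
Proof.
by move=> /eqP e; rewrite /in_L2 /flip /over /under /= -e minC maxC.
Qed.

Lemma index_term_flipl D c x : is_self c ->
  index_term D (flip c) x = index_term D c x.
Proof. by move=> e; rewrite /index_term !in_L1_flip ?in_L2_flip. Qed.

Lemma sgz_subr (x y : R) : sgz (y - x) = (x < y)%R%:Z - (y < x)%R%:Z.
Proof. by case: (ltgtP x y) => h; case: sgzP => h1 //; exfalso; move: h h1;
  lra. Qed.

(** The sign of q - p, for [c] with preimages p and q, records which of
    the two smoothed components is called the first one; only the absolute
    value of the index is used, so it disappears in
    [signed_interlacing_index]. For [x = c] both sides vanish. *)
Lemma interlacing_index_term D c x : is_self c ->
  (over c).2 != (under c).2 ->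
  [&& over x != over c, over x != under c,
      under x != over c & under x != under c] || (x == c) ->
  (if is_self x then sgn D x * interlacing c x else 0) =
  2 * sgz ((under c).2 - (over c).2) * index_term D c x.
Proof.
move=> sc pq; case/orP; last first.
  by move=> /eqP->; rewrite interlacingxx index_termxx !mulr0 if_same.
case: c sc pq => [[[i p] [j q]] kc]; case: x => [[[k u] [l v]] kx].
rewrite /is_self /over /under /interlacing /sgn /order_sign /index_term.
rewrite /in_L1 /in_L2 /over /under /=.
move=> /eqP/= <- {j} pq; rewrite ![(k, _) == _]xpair_eqE
  ![(l, _) == _]xpair_eqE.
case: (eqVneq k i) => [->|ki] /=; last first.
  case: (eqVneq k l) => [<-|kl] /=; last by rewrite !andbF mulr0.
  by rewrite (eq_sym i k) (negbTE ki) /= ?addr0 ?subr0 ?mulr0.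
case: (eqVneq l i) => [->|li] /=; last by rewrite !andbF ?mulr0.
case/and4P=> up uq vp vq.
rewrite (sign_atC D (i, u) (i, v)).
move: (sign_at _ _ _) => s; rewrite !sgz_subr !lt_min !gt_max !gt_min !lt_max.
case: (ltgtP p q) pq => // pq _; case: (ltgtP u p) up => // up _;
case: (ltgtP u q) uq => // uq _; case: (ltgtP v p) vp => // vp _;
case: (ltgtP v q) vq => // vq _ /=; try ring; exfalso; lra.
Qed.

End Interlacing.

(** * State sums over classical crossings *)

Definition state_weight (R : realType) (n : nat) (V : zmodType)
    (f : 'I_n -> nat -> V) (g : 'I_n -> 'I_n -> V) (c : crossing R n)
    (m : nat) : V :=
  if is_self c then f (over c).1 m else g (over c).1 (under c).1.

Definition state_sum (R : realType) (n : nat) (V : zmodType)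
    (f : 'I_n -> nat -> V) (g : 'I_n -> 'I_n -> V) (D : diagram R n) : V :=
  \sum_(c <- crossings D | c.2 == Classical)
    state_weight f g c `|intersection_index D c|%N *~ sgn D c.

Lemma eq_big_seq_cond (V : zmodType) (T : eqType) (s : seq T) (P : pred T)
  (F G : T -> V) :
  (forall x, x \in s -> P x -> F x = G x) ->
  \sum_(x <- s | P x) F x = \sum_(x <- s | P x) G x.
Proof.
move=> e; rewrite big_seq_cond [RHS]big_seq_cond.
by apply: eq_bigr => x /andP[]; exact: e.
Qed.

Lemma big_seq1_cond (V : zmodType) (T : Type) (P : pred T) (F : T -> V) a :
  \sum_(x <- [:: a] | P x) F x = if P a then F a else 0.
Proof. by rewrite big_mkcond big_seq1. Qed.

Lemma big_seq2_cond (V : zmodType) (T : Type) (P : pred T) (F : T -> V) a b :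
  \sum_(x <- [:: a; b] | P x) F x =
  (if P a then F a else 0) + (if P b then F b else 0).
Proof. by rewrite big_mkcond !big_cons big_nil /= addr0. Qed.

Lemma big_seq3_cond (V : zmodType) (T : Type) (P : pred T) (F : T -> V) a b c :
  \sum_(x <- [:: a; b; c] | P x) F x =
  (if P a then F a else 0) + ((if P b then F b else 0) +
  (if P c then F c else 0)).
Proof. by rewrite big_mkcond !big_cons big_nil /= addr0. Qed.

Section StateSum.
Context (R : realType) (n : nat).
Implicit Types (D : diagram R n) (p q : point R n) (c x : crossing R n).
Implicit Types (X rest : seq (crossing R n)).

Lemma over_neq_under D c x : generic D ->
  c \in crossings D -> x \in crossings D -> over c != under x.
Proof.
move=> gD cD xD; have := generic_uniq gD.
rewrite cat_uniq => /and3P[_ /hasPn ou _]; apply/eqP => e.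
by have /negP := ou _ (map_f (@under R n) xD); apply; rewrite /= -e map_f.
Qed.

Lemma crossing_points_distinct D c x :
  generic D -> c \in crossings D -> x \in crossings D ->
  [&& over x != over c, over x != under c,
      under x != over c & under x != under c] || (x == c).
Proof.
move=> gD cD xD; case: (eqVneq x c) => [|xc]; first by rewrite orbT.
have := generic_uniq gD; rewrite cat_uniq => /and3P[uo _ uu].
have inj (T : eqType) (h : crossing R n -> T) :
    uniq (map h (crossings D)) -> h x != h c.
  move=> uh; apply: contra_neq xc => e.
  have := @nth_uniq _ (h c) _ (index x (crossings D)) (index c (crossings D))
    _ _ uh; rewrite size_map !index_mem => /(_ xD cD).
  rewrite !(nth_map c) ?index_mem// !nth_index// e eqxx => /esym/eqP ei.
  by rewrite -(nth_index c xD) ei nth_index.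
by rewrite !inj//= orbF andbT (over_neq_under gD xD cD) eq_sym
  (over_neq_under gD cD xD).
Qed.

Lemma signed_interlacing_index D c :
  generic D -> c \in crossings D -> is_self c ->
  `|intersection_index D c|%N =
  (`|signed_interlacing D (crossings D) c|%N)./2.
Proof.
move=> gD cD sc.
have pq : (over c).2 != (under c).2.
  apply: contraNneq (over_neq_under gD cD cD) => e.
  by rewrite (surjective_pairing (over c)) e (eqP sc) -surjective_pairing.
have -> : signed_interlacing D (crossings D) c =
    2 * sgz ((under c).2 - (over c).2) * intersection_index D c.
  rewrite /signed_interlacing big_mkcondr /= /intersection_index mulr_sumr.
  apply: eq_big_seq_cond => x xD _.
  by rewrite interlacing_index_term// (crossing_points_distinct gD).
rewrite !abszM; case: sgzP => [/eqP|_|_].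
- by rewrite subr_eq0 eq_sym (negbTE pq).
- by rewrite muln1 mul2n doubleK.
- by rewrite muln1 mul2n doubleK.
Qed.

Context (V : zmodType) (f : 'I_n -> nat -> V) (g : 'I_n -> 'I_n -> V).

(** The contribution of [c] to the state sum when the signed interlacing
    number of [c] is [N], twice its index up to sign. *)
Definition interlacing_value D c (N : int) : V :=
  state_weight f g c (`|N|%N)./2 *~ sgn D c.

Lemma state_sumE D : generic D ->
  state_sum f g D = \sum_(c <- crossings D | c.2 == Classical)
    interlacing_value D c (signed_interlacing D (crossings D) c).
Proof.
move=> gD; rewrite /state_sum; apply: eq_big_seq_cond => c cD _;
  rewrite /interlacing_value /state_weight.
by case: ifP => // sc; rewrite signed_interlacing_index.
Qed.

Lemma signed_interlacing_cat D X rest c :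
  signed_interlacing D (X ++ rest) c =
  signed_interlacing D X c + signed_interlacing D rest c.
Proof. by rewrite /signed_interlacing big_cat. Qed.

Lemma eq_signed_interlacing D D' X c :
  (forall x, x \in X -> sgn D x = sgn D' x) ->
  signed_interlacing D X c = signed_interlacing D' X c.
Proof.
by move=> e; apply: eq_big_seq_cond => x xX _; rewrite e.
Qed.

Lemma eq_interlacing_value D D' c c' N N' :
  (over c).1 = (over c').1 -> (under c).1 = (under c').1 ->
  sgn D c = sgn D' c' -> (is_self c -> N = N') ->
  interlacing_value D c N = interlacing_value D' c' N'.
Proof.
rewrite /interlacing_value /state_weight /is_self => <- <- ->.
by case: ifP => // _ ->.
Qed.

(** The two crossings removed by a move 2 satisfy these hypotheses. *)
Lemma interlacing_value_opp D c c' N N' :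
  (over c).1 = (over c').1 -> (under c).1 = (under c').1 ->
  sgn D c' = - sgn D c -> (is_self c -> N = N') ->
  interlacing_value D c N + interlacing_value D c' N' = 0.
Proof.
rewrite /interlacing_value /state_weight /is_self => <- <- ->.
by case: ifP => [_ ->//|_ _]; rewrite mulrNz addrN.
Qed.

(** A move leaves unchanged the contributions of the crossings outside of
    its disc as soon as they see the same total interlacing inside; what
    remains is to compare the contributions from the disc. *)
Lemma state_sum_local D D' X X' rest :
  generic D -> generic D' ->
  crossings D = X ++ rest -> crossings D' = X' ++ rest ->
  (forall c, c \in rest -> sgn D c = sgn D' c) ->
  (forall c, c \in rest -> is_self c ->
     signed_interlacing D X c = signed_interlacing D' X' c) ->
  \sum_(c <- X | c.2 == Classical)
    interlacing_value D c (signed_interlacing D X c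
                           + signed_interlacing D rest c) =
  \sum_(c <- X' | c.2 == Classical)
    interlacing_value D' c (signed_interlacing D' X' c
                            + signed_interlacing D rest c) ->
  state_sum f g D = state_sum f g D'.
Proof.
move=> gD gD' eX eX' es eI eV.
rewrite (state_sumE gD) (state_sumE gD') eX eX'.
rewrite big_cat [RHS]big_cat.
rewrite /=.
apply: (f_equal2 +%R).
  etransitivity; last first.
    etransitivity; first exact: eV.
    apply: eq_bigr => c _.
    rewrite signed_interlacing_cat.
    by rewrite (eq_signed_interlacing c es).
  apply: eq_bigr => c _.
  by rewrite signed_interlacing_cat.
apply: eq_big_seq_cond.
move=> c cr _.
apply: eq_interlacing_value; [by []|by []|exact: es|].
move=> sc.
rewrite signed_interlacing_cat.
rewrite (eI c cr sc).
rewrite signed_interlacing_cat.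
congr (_ + _).
exact: eq_signed_interlacing.
Qed.

End StateSum.

(** * Points and tangents near the strands of a move *)

Section Strands.
Context (R : realType) (n : nat).
Implicit Types (D : diagram R n) (p q : point R n) (S T : strand R n).

Lemma sgz_near (x y : R) : `|x - y| < `|y| -> sgz x = sgz y.
Proof.
case: (ltgtP y 0) => h.
- rewrite (ltr0_norm h) ltr_norml => /andP[_ h1].
  by rewrite !ltr0_sgz//; lra.
- rewrite (gtr0_norm h) ltr_norml => /andP[h1 _].
  by rewrite !gtr0_sgz//; lra.
- by rewrite h normr0 normr_lt0.
Qed.

(** Seen from outside, the points of a strand cannot be told apart. *)
Lemma order_sign_strand S p u : ~~ on_strand S p -> `|u| <= 1 ->
  order_sign p (at_strand S u) = order_sign p (at_strand S 0).
Proof.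
rewrite /on_strand /order_sign /= negb_and; case: eqP => //= _ hp hu.
apply: sgz_near; move: hp; rewrite -ltNge distrC mulr0 addr0.
apply: le_lt_trans; rewrite opprB addrA subrK addrAC subrr add0r normrM.
by rewrite -[leRHS]mulr1; apply: ler_wpM2l.
Qed.

Lemma order_sign_disjoint S T u v : disjoint_strands S T ->
  `|u| <= 1 -> `|v| <= 1 ->
  order_sign (at_strand S u) (at_strand T v) =
  order_sign (at_strand S 0) (at_strand T 0).
Proof.
rewrite /disjoint_strands /order_sign /=; case: eqP => //= _ hd hu hv.
apply: sgz_near; rewrite !mulr0 !addr0 (distrC (smid T)).
apply: le_lt_trans hd.
have -> : smid T + shalf T * v - (smid S + shalf S * u) - (smid T - smid S) =
  shalf T * v - shalf S * u by ring.
rewrite (le_trans (ler_normB _ _))// addrC !normrM lerD//.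
- by rewrite -[leRHS]mulr1; apply: ler_wpM2l.
- by rewrite -[leRHS]mulr1; apply: ler_wpM2l.
Qed.

Lemma order_sign_same_strand S u v :
  order_sign (at_strand S u) (at_strand S v) = sgz (shalf S) * sgz (v - u).
Proof.
by rewrite /order_sign eqxx /= -sgzM; congr sgz; ring.
Qed.

End Strands.

Lemma derive1_right (R : realType) (h : R -> R) (t : R) : derivable h t 1 ->
  (z^-1 *: (h (z + t) - h t) @[z --> 0^'+] --> h^`() t)%classic.
Proof.
move=> dh; apply: cvg_dnbhs_at_right.
rewrite /derive1; move: dh; rewrite /derivable.
set d := (fun _ : R => _); set d' := (fun _ : R => _).
suff -> : d = d' by [].
by rewrite funeqE => z; rewrite /d /d' /= [z%:A]mulr1.
Qed.

(** A one-sided germ determines a derivative that is known to exist. This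
    is needed at the base point 0 of a closed component, where the
    diagrams are compared on [0, 1[ only. *)
Lemma derive1_eq_right (R : realType) (h k : R -> R) (t e : R) : 0 < e ->
  derivable h t 1 -> derivable k t 1 ->
  (forall s, t <= s < t + e -> h s = k s) -> h^`()%classic t = k^`()%classic t.
Proof.
move=> e0 dh dk hk.
apply: (@cvg_unique _ _ (z^-1 *: (h (z + t) - h t) @[z --> 0^'+])%classic).
- exact: norm_hausdorff.
- exact: derive1_right.
apply: cvg_trans (derive1_right dk); apply: near_eq_cvg.
near=> z.
have z0 : 0 < z by near: z; exact: nbhs_right_gt.
have ze : z < e by near: z; exact: nbhs_right_lt.
rewrite !hk//; lra.
Unshelve. all: by end_near.
Qed.

Definition has_velocity (R : realType) (m : R -> plane R) (u : R)
    (d : plane R) : Prop :=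
  is_derive u 1 (fun v => (m v).1) d.1 /\ is_derive u 1 (fun v => (m v).2) d.2.

Section LocalTangents.
Context (R : realType) (n : nat).
Implicit Types (D : diagram R n) (p q : point R n) (S T : strand R n).

Lemma derive1_affine (h k : R -> R) (a b c r u d : R) :
  (forall t, derivable h t 1) -> is_derive u 1 k d -> -1 <= u < 1 ->
  (forall v, -1 <= v <= 1 -> h (a + b * v) = c + r * k v) ->
  b * h^`()%classic (a + b * u) = r * d.
Proof.
move=> dh dk /andP[u1 u2] e.
have da : is_derive u 1 (fun v => a + b * v) b.
  by apply: is_derive_eq; rewrite /GRing.scale /=; ring.
have dl : is_derive u 1 (h \o (fun v => a + b * v))
  (h^`()%classic (a + b * u) * b).
  have dh' : is_derive (a + b * u) 1 h (h^`()%classic (a + b * u)).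
    by rewrite derive1E; exact/derivableP.
  exact: is_derive1_comp.
have dr : is_derive u 1 (fun v => c + r * k v) (r * d).
  by apply: is_derive_eq; rewrite /GRing.scale /=; ring.
have := @derive1_eq_right R (h \o (fun v => a + b * v)) (fun v => c + r * k v)
  u (1 - u).
rewrite (derive1E (h \o _)) derive1E (@derive_val _ _ _ _ _ _ _ dl)
  (@derive_val _ _ _ _ _ _ _ dr) mulrC.
apply; first by lra.
- exact: ex_derive.
- exact: ex_derive.
- by move=> s hs; rewrite /= e//; lra.
Qed.

Lemma tangent_drawn D o r S m u d : generic D -> drawn_as D o r S m ->
  has_velocity m u d -> -1 <= u < 1 ->
  shalf S * (tangent D (at_strand S u)).1 = r * d.1 /\
  shalf S * (tangent D (at_strand S u)).2 = r * d.2.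
Proof.
move=> gD dS [d1 d2] hu.
have [hd _] := generic_C1 gD (scomp S).
split; apply: derive1_affine hu _ => //.
- move=> t; exact: (hd t).1.
- by move=> v hv; have := dS v hv; rewrite /image /= => ->.
- move=> t; exact: (hd t).2.
- by move=> v hv; have := dS v hv; rewrite /image /= => ->.
Qed.

(** In a disc where the strands follow model curves, the sign of a
    crossing is that of the models corrected by the directions in which
    the strands are run through. *)
Lemma sign_at_drawn D o r S T m m' u v d d' : generic D -> 0 < r ->
  shalf S != 0 -> shalf T != 0 ->
  drawn_as D o r S m -> drawn_as D o r T m' ->
  has_velocity m u d -> has_velocity m' v d' -> -1 <= u < 1 -> -1 <= v < 1 ->
  sign_at D (at_strand S u) (at_strand T v) =
  sgz (shalf S) * sgz (shalf T) * sgz (det d d').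
Proof.
move=> gD r0 S0 T0 dS dT vS vT hu hv.
have [e1 e2] := tangent_drawn gD dS vS hu.
have [e3 e4] := tangent_drawn gD dT vT hv.
have : r ^+ 2 * det d d' = shalf S * shalf T *
    det (tangent D (at_strand S u)) (tangent D (at_strand T v)).
  rewrite /det; transitivity (r * d.1 * (r * d'.2) - r * d.2 * (r * d'.1)).
    by ring.
  by rewrite -e1 -e2 -e3 -e4; ring.
move/(congr1 (@sgz R)); rewrite (sgzM (r ^+ 2)) (gtr0_sgz (exprn_gt0 2 r0))
  mul1r => ->.
rewrite (sgzM (shalf S * _)) (sgzM (shalf S)) mulrA -[LHS]mul1r; congr (_ * _).
by case: (sgzP (shalf S)) S0 => // _ _; case: (sgzP (shalf T)) T0.
Qed.

Lemma outside_right (W : seq (strand R n * (R -> plane R) * (R -> plane R)))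
    (i : 'I_n) (t : R) :
  ~~ has (fun w => on_strand w.1.1 (i, t)) W ->
  exists2 e, 0 < e & forall s, t <= s < t + e ->
    ~~ has (fun w => on_strand w.1.1 (i, s)) W.
Proof.
elim: W => [|w W IH] /=; first by exists 1.
rewrite negb_or => /andP[hw /IH[e e0 he]].
suff [e' e'0 he'] : exists2 e', 0 < e' & forall s, t <= s < t + e' ->
    ~~ on_strand w.1.1 (i, s).
  exists (Num.min e e'); first by rewrite lt_min e0.
  move=> s /andP[s1 s2]; rewrite negb_or he' ?he// s1/=.
    by apply: lt_le_trans s2 _; rewrite lerD2l ge_min lexx.
  by apply: lt_le_trans s2 _; rewrite lerD2l ge_min lexx orbT.
move: hw; rewrite /on_strand negb_and /=; case: eqP => [_|_] /=; last
  by exists 1.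
rewrite -ltNge => hw; exists (`|t - smid w.1.1| - `|shalf w.1.1|); first by lra.
move=> s /andP[s1 s2]; rewrite -ltNge.
have := ler_distD s t (smid w.1.1).
by rewrite (distrC t s) (ger0_norm (_ : 0 <= s - t)); lra.
Qed.

(** The images agree outside of the strands, which are closed, so they
    agree immediately to the right of any parameter outside. *)
Lemma tangent_outside D D'
    (W : seq (strand R n * (R -> plane R) * (R -> plane R))) p :
  generic D -> generic D' ->
  (forall q, in_domain D q -> ~~ has (fun w => on_strand w.1.1 q) W ->
     image D q = image D' q) ->
  in_interior D p -> ~~ has (fun w => on_strand w.1.1 p) W ->
  tangent D p = tangent D' p.
Proof.
case: p => i t gD gD' eI ip /outside_right[e e0 he].
have [t0 t1] : 0 <= t /\ t < 1.
  by move: ip; rewrite /in_interior /=; case: ifP => _; lra.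
have [hd _] := generic_C1 gD i; have [hd' _] := generic_C1 gD' i.
have e1 : 0 < Num.min e (1 - t) by rewrite lt_min e0; lra.
(* Staying below 1 keeps the parameter in the domain. *)
have eq s : t <= s < t + Num.min e (1 - t) -> curve D i s = curve D' i s.
  move=> /andP[s1 s2]; apply: (eI (i, s)).
    rewrite /in_domain /=.
    have : s < t + (1 - t) by rewrite (lt_le_trans s2)// lerD2l ge_min lexx
      orbT.
    by case: ifP => _; lra.
  by apply: he; rewrite s1 (lt_le_trans s2)// lerD2l ge_min lexx.
rewrite /tangent /velocity; congr (_, _); apply: (derive1_eq_right e1) => /=.
- exact: (hd t).1.
- exact: (hd' t).1.
- by move=> s hs; rewrite eq.
- exact: (hd t).2.
- exact: (hd' t).2.
- by move=> s hs; rewrite eq.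
Qed.

End LocalTangents.

Section ModelVelocities.
Context (R : realType).

Lemma velocity_horizontal (h u : R) : has_velocity (horizontal h) u (1, 0).
Proof. split; rewrite /horizontal /=; exact: is_derive_eq. Qed.

Lemma velocity_dip (u : R) :
  has_velocity (@dip R) u (1, 4 * u * (1 - u ^+ 2)).
Proof.
split; rewrite /dip /=; first exact: is_derive_eq.
by apply: is_derive_eq; rewrite /GRing.scale /=; ring.
Qed.

Lemma velocity_rising_left (e u : R) : has_velocity (rising_left e) u
  (e * (1 / 2 + 16 / 9 * u * (1 - u ^+ 2)), 1).
Proof.
split; rewrite /rising_left /=; last exact: is_derive_eq.
by apply: is_derive_eq; rewrite /GRing.scale /=; field.
Qed.

Lemma velocity_rising_right (e u : R) : has_velocity (rising_right e) u
  (e * (1 / 2 - 16 / 9 * u * (1 - u ^+ 2)), 1).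
Proof.
split; rewrite /rising_right /=; last exact: is_derive_eq.
by apply: is_derive_eq; rewrite /GRing.scale /=; field.
Qed.

End ModelVelocities.

(** * State sums under local moves *)

Section LocalMoves.
Context (R : realType) (n : nat).
Implicit Types (D : diagram R n) (p q : point R n) (S T : strand R n).
Implicit Types (c x : crossing R n) (rest X : seq (crossing R n)).
Implicit Types (W : seq (strand R n * (R -> plane R) * (R -> plane R))).

Definition inside W p : bool := has (fun w => on_strand w.1.1 p) W.

(** Two crossings in the disc of a move, between the same strands, which
    no point outside of the disc can distinguish. *)
Definition seen_alike W x x' : Prop :=
  [/\ (over x).1 = (over x').1, (under x).1 = (under x').1 &
      forall p, ~~ inside W p ->
        order_sign p (over x) = order_sign p (over x') /\
        order_sign p (under x) = order_sign p (under x')].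

Lemma seen_alike_interlacing W x x' c : seen_alike W x x' ->
  ~~ inside W (over c) -> ~~ inside W (under c) ->
  interlacing c x = interlacing c x'.
Proof.
case=> _ _ h oc uc; rewrite /interlacing.
by have [-> ->] := h _ oc; have [-> ->] := h _ uc.
Qed.

Lemma seen_alike_self W x x' : seen_alike W x x' -> is_self x = is_self x'.
Proof. by rewrite /is_self => -[-> -> _]. Qed.

Lemma seen_alike_rest W x x' D rest : seen_alike W x x' ->
  (forall c, c \in rest -> ~~ inside W (over c) /\ ~~ inside W (under c)) ->
  signed_interlacing D rest x = signed_interlacing D rest x'.
Proof.
move=> a h; apply: eq_big_seq_cond => c /h[oc uc] _.
by rewrite interlacingC (seen_alike_interlacing a oc uc) -interlacingC.
Qed.

Lemma seen_alike_strands W S T b k u v u' v' :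
  (forall p, ~~ inside W p -> ~~ on_strand S p /\ ~~ on_strand T p) ->
  `|u| <= 1 -> `|v| <= 1 -> `|u'| <= 1 -> `|v'| <= 1 ->
  seen_alike W (mk_crossing b (at_strand S u) (at_strand T v) k)
               (mk_crossing b (at_strand S u') (at_strand T v') k).
Proof.
move=> h hu hv hu' hv'; case: b => /=; split => // p /h[pS pT];
  rewrite /over /under /=;
  rewrite (order_sign_strand pS hu) (order_sign_strand pT hv);
  by rewrite (order_sign_strand pS hu') (order_sign_strand pT hv').
Qed.

Context (V : zmodType) (f : 'I_n -> nat -> V) (g : 'I_n -> 'I_n -> V).

(** All moves reduce to two verifications inside the disc: what outer
    crossings see, and what the crossings of the disc contribute. *)
Lemma state_sum_local_move D D' W X X' : local_move D D' W X X' ->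
  (forall o r rest, generic D -> generic D' -> 0 < r ->
     all (fun w => wf_strand w.1.1) W ->
     pairwise (fun w w' => disjoint_strands w.1.1 w'.1.1) W ->
     (forall w, List.In w W ->
        drawn_as D o r w.1.1 w.1.2 /\ drawn_as D' o r w.1.1 w.2) ->
     (forall c, c \in rest -> ~~ inside W (over c) /\ ~~ inside W (under c)) ->
     (forall c, ~~ inside W (over c) -> ~~ inside W (under c) ->
        signed_interlacing D X c = signed_interlacing D' X' c) /\
     \sum_(c <- X | c.2 == Classical)
       interlacing_value f g D c (signed_interlacing D X c
                                  + signed_interlacing D rest c) =
     \sum_(c <- X' | c.2 == Classical)
       interlacing_value f g D' c (signed_interlacing D' X' c
                                   + signed_interlacing D rest c)) ->
  state_sum f g D = state_sum f g D'.
Proof.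
case=> -[gD gD' _] [o [r [rest [[r0 _] /andP[wf dj] dr out [eX eX' hr]]]]] H.
have [H1 H2] := H o r rest gD gD' r0 wf dj dr hr.
have rD c : c \in rest -> c \in crossings D.
  by move=> cr; rewrite eX mem_cat cr orbT.
apply: (state_sum_local gD gD' eX eX' _ _ H2) => c cr; last first.
  by have [h1 h2] := hr c cr; move=> _; exact: H1.
have [h1 h2] := hr c cr; have [i1 i2 _ _] := generic_sound gD (rD c cr).
have oo p : in_domain D p -> ~~ inside W p -> image D p = image D' p.
  by move=> pD pW; have [] := out p pD pW.
by rewrite /sgn /sign_at (tangent_outside gD gD' oo i1 h1)
  (tangent_outside gD gD' oo i2 h2).
Qed.

(** Both ends of the chord of the kink lie on one strand, so it meets no
    other chord and has index 0. *)
Lemma reidemeister1_state_sum D D' : (forall i, f i 0 = 0) ->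
  reidemeister1 D D' -> state_sum f g D = state_sum f g D'.
Proof.
move=> f0 [S [b [k [_ lm]]]]; apply: (state_sum_local_move lm).
move=> o r rest gD gD' r0 _ _ dr hr.
set x := mk_crossing _ _ _ _.
have half (e : R) : e = - (1 / 2) \/ e = 1 / 2 -> `|e| <= 1.
  by case=> ->; rewrite ?normrN ger0_norm; lra.
have x0 c : ~~ inside [:: (S, @curl R, horizontal 0)] (over c) ->
    ~~ inside [:: (S, @curl R, horizontal 0)] (under c) -> interlacing c x = 0.
  rewrite /inside /= !orbF => oc uc; rewrite /interlacing /x.
  by case: (b); rewrite /over /under /=;
    rewrite !(order_sign_strand oc) ?(order_sign_strand uc) ?half //;
    try (by left); try (by right); ring.
split.
  move=> c oc uc; rewrite /signed_interlacing big_cons !big_nil x0//.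
  by rewrite mulr0 addr0 if_same.
rewrite big_seq1_cond [RHS]big_nil; case: (x.2 == Classical); last by [].
have sx : is_self x by rewrite /x; case: (b); rewrite /is_self /over/=.
rewrite /signed_interlacing big_cons big_nil interlacingxx mulr0 addr0 if_same.
rewrite big1_seq => [|c /andP[_ cr]]; last first.
  by have [oc uc] := hr c cr; rewrite interlacingC x0// oppr0 mulr0.
by rewrite addr0 /interlacing_value /state_weight sx absz0 f0 mul0rz.
Qed.

End LocalMoves.

Section Moves23.
Context (R : realType) (n : nat).
Implicit Types (D : diagram R n) (p q : point R n) (S T : strand R n).
Implicit Types (c x : crossing R n) (rest X : seq (crossing R n)).
Implicit Types (W : seq (strand R n * (R -> plane R) * (R -> plane R))).
Context (V : zmodType) (f : 'I_n -> nat -> V) (g : 'I_n -> 'I_n -> V).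

Lemma sgn_mk_crossing D b p q k :
  sgn D (mk_crossing b p q k) = (if b then 1 else -1) * sign_at D p q.
Proof.
by case: b; rewrite /sgn /over /under /= ?mul1r // sign_atC mulN1r.
Qed.

(** The dip crosses the horizontal strand in both directions, so the two
    crossings have opposite signs. Their indices are equal: their chords
    have the same form with any outer chord, and with each other the
    contributions are sgn y (x, y) and sgn x (y, x), equal by the two
    changes of sign. *)
Lemma reidemeister2_state_sum D D' :
  reidemeister2 D D' -> state_sum f g D = state_sum f g D'.
Proof.
case=> [A [B [b [k [_ lm]]]]]; apply: (state_sum_local_move lm).
move=> o r rest gD gD' r0 wf dj dr hr; set W := [:: _; _] in lm wf dj dr hr *.
set x := mk_crossing b (at_strand A _) (at_strand B _) _.
set y := mk_crossing b (at_strand A _) (at_strand B _) _.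
have h1 : `|- (1 / 2) : R| <= 1 by rewrite normrN ger0_norm; lra.
have h2 : `|1 / 2 : R| <= 1 by rewrite ger0_norm; lra.
have xy : seen_alike W x y.
  apply: seen_alike_strands => // p.
  by rewrite /inside /= orbF negb_or => /andP.
move: wf; rewrite /W /= andbT => /andP[/and3P[A0 _ _] /and3P[B0 _ _]].
move: dj; rewrite /W /= !andbT => dj.
have [dA _] := dr _ (or_introl erefl).
have [dB _] := dr _ (or_intror (or_introl erefl)).
have lt1 : (-1 <= - (1 / 2) :> R) && (- (1 / 2) < 1 :> R).
  by apply/andP; split; lra.
have lt2 : (-1 <= 1 / 2 :> R) && (1 / 2 < 1 :> R) by apply/andP; split; lra.
have sxy : sgn D y = - sgn D x.
  rewrite !sgn_mk_crossing -[RHS]mulrN; congr (_ * _).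
  rewrite (sign_at_drawn gD r0 A0 B0 dA dB (velocity_horizontal 0 _)
    (velocity_dip _) lt1 lt1).
  rewrite (sign_at_drawn gD r0 A0 B0 dA dB (velocity_horizontal 0 _)
    (velocity_dip _) lt2 lt2).
  rewrite -[RHS]mulrN; congr (_ * _); rewrite /det /=.
  by rewrite gtr0_sgz ?ltr0_sgz //; lra.
have kxy : x.2 = y.2 by rewrite /x /y; case: (b).
have Ixy c : signed_interlacing D [:: x; y] c =
    if (x.2 == Classical) && is_self x
    then sgn D x * (interlacing c x - interlacing c y) else 0.
  rewrite /signed_interlacing big_seq2_cond -(seen_alike_self xy) -kxy sxy.
  by case: (_ && _); [ring|rewrite addr0].
split.
  move=> c oc uc; rewrite Ixy (seen_alike_interlacing xy oc uc) subrr mulr0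
    if_same.
  by rewrite /signed_interlacing big_nil.
rewrite big_seq2_cond big_nil -kxy.
case: (x.2 == Classical); last by rewrite addr0.
have [e1 e2 _] := xy.
apply: (interlacing_value_opp _ _ e1 e2 sxy) => _.
rewrite (seen_alike_rest D xy hr) !Ixy; congr (_ + _).
rewrite !interlacingxx (interlacingC x y); case: ifP => // _; ring.
Qed.

(** On each strand of a move 3 two chord ends are exchanged: those of AB
    and CA on A, those of AB and CB on B, those of CA and CB on C. Each
    exchange changes the form of the two chords by twice the direction of
    the strand. In the index of AB, say, the changes add up to a multiple
    of sgn(CA) dir(A) - sgn(CB) dir(B), which is dir(C) - dir(C) because
    the sign of a crossing is the product of the directions of its
    strands. The abscissae [h] and [q] stand for 1/2 and 4/9. *)
Lemma triangle_interlacing A B C (b bAB : bool) (k kAB : kind) (h q : R) :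
  disjoint_strands A B -> disjoint_strands A C -> disjoint_strands B C ->
  shalf A != 0 -> shalf B != 0 -> shalf C != 0 ->
  0 < h <= 1 -> 0 < q <= 1 ->
  let sign (b : bool) S T : int :=
    (if b then 1 else -1) * (sgz (shalf S) * sgz (shalf T)) in
  let x u := mk_crossing bAB (at_strand A u) (at_strand B u) kAB in
  let y u := mk_crossing b (at_strand C u) (at_strand A 0) k in
  let z u := mk_crossing b (at_strand C u) (at_strand B 0) k in
  [/\ sign b C A * interlacing (x h) (y (- q))
      + sign b C B * interlacing (x h) (z q)
      = sign b C A * interlacing (x (- h)) (y q)
      + sign b C B * interlacing (x (- h)) (z (- q)),
      sign bAB A B * interlacing (y (- q)) (x h)
      + sign b C B * interlacing (y (- q)) (z q)
      = sign bAB A B * interlacing (y q) (x (- h))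
      + sign b C B * interlacing (y q) (z (- q)) &
      sign bAB A B * interlacing (z q) (x h)
      + sign b C A * interlacing (z q) (y (- q))
      = sign bAB A B * interlacing (z (- q)) (x (- h))
      + sign b C A * interlacing (z (- q)) (y q)].
Proof.
move=> dAB dAC dBC A0 B0 C0 /andP[h0 h1] /andP[q0 q1].
have unit S : shalf S != 0 -> sgz (shalf S) = 1 \/ sgz (shalf S) = -1.
  by case: (ltgtP (shalf S) 0) => [e|e|//] _;
    [rewrite ltr0_sgz//; right|rewrite gtr0_sgz//; left].
have dm S T : disjoint_strands S T -> disjoint_strands T S.
  by rewrite /disjoint_strands eq_sym addrC (distrC (smid S)).
have r0 : `|0 : R| <= 1 by rewrite normr0.
have rh : `|h| <= 1 by rewrite gtr0_norm.
have rh' : `|- h| <= 1 by rewrite normrN.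
have rq : `|q| <= 1 by rewrite gtr0_norm.
have rq' : `|- q| <= 1 by rewrite normrN.
have down (e : R) : 0 < e -> sgz (0 - e) = -1.
  by move=> ?; rewrite ltr0_sgz; lra.
have up (e : R) : 0 < e -> sgz (- e - 0) = -1.
  by move=> ?; rewrite ltr0_sgz; lra.
have down' (e : R) : 0 < e -> sgz (e - 0) = 1.
  by move=> ?; rewrite gtr0_sgz; lra.
have up' (e : R) : 0 < e -> sgz (0 - - e) = 1.
  by move=> ?; rewrite gtr0_sgz; lra.
have far (e : R) : 0 < e -> sgz (e - - e) = 1.
  by move=> ?; rewrite gtr0_sgz; lra.
have far' (e : R) : 0 < e -> sgz (- e - e) = -1.
  by move=> ?; rewrite ltr0_sgz; lra.
have sep S T : disjoint_strands S T -> exists e : int, forall u v : R,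
    `|u| <= 1 -> `|v| <= 1 ->
    order_sign (at_strand S u) (at_strand T v) = e /\
    order_sign (at_strand T v) (at_strand S u) = - e.
  move=> d; exists (order_sign (at_strand S 0) (at_strand T 0)) => u v hu hv.
  rewrite (order_sign_disjoint d)// (order_sign_disjoint (dm _ _ d))//.
  by rewrite (order_signC (at_strand S 0)).
have [ab hab] := sep _ _ dAB.
have [ac hac] := sep _ _ dAC.
have [bc hbc] := sep _ _ dBC.
have h1' u v hu hv := (hab u v hu hv).1.
have h2' u v hu hv := (hab u v hu hv).2.
have h3' u v hu hv := (hac u v hu hv).1.
have h4' u v hu hv := (hac u v hu hv).2.
have h5' u v hu hv := (hbc u v hu hv).1.
have h6' u v hu hv := (hbc u v hu hv).2.
have oA := @order_sign_same_strand R n A.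
have oB := @order_sign_same_strand R n B.
have oC := @order_sign_same_strand R n C.
rewrite /interlacing; case: b; case: bAB => /=; rewrite /over /under /=;
  rewrite ?(h1', h2', h3', h4', h5', h6')// ?oA ?oB ?oC;
  rewrite ?up' ?up ?down ?down' ?far ?far'//;
  case: (unit A A0) => ->; case: (unit B B0) => ->; case: (unit C C0) => ->;
  split; ring.
Qed.

(** If the third strand is virtual, the two crossings on it are not
    counted and only the order of points outside matters. Otherwise all
    three crossings are classical and [triangle_interlacing] applies when
    A, B and C lie on one component; when they do not, no two of the three
    crossings are self-crossings of the same component. *)
Lemma reidemeister3_state_sum D D' : double_point_count D = 0%N ->
  reidemeister3 D D' -> state_sum f g D = state_sum f g D'.
Proof.
move=> sD [A [B [C [b [bAB [k [kAB [kS kv lm]]]]]]]].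
have kABS : kAB <> Singular.
  case: lm => _ [o [r [rest [_ _ _ _ [eX _ _]]]]] e.
  move: sD; rewrite /double_point_count eX e /=.
  by case: (bAB); rewrite /= eqxx.
have {kv kABS} kv : k = Classical -> kAB = Classical.
  by move=> /kv; case: (kAB) kABS.
apply: (state_sum_local_move lm).
move=> o r rest gD gD' r0 wf dj dr hr.
set W := [:: _; _; _] in lm wf dj dr hr *.
move: wf; rewrite /W /= andbT.
move=> /and3P[/and3P[A0 _ _] /and3P[B0 _ _] /and3P[C0 _ _]].
move: dj; rewrite /W /= !andbT => /andP[/andP[dAB dAC] dBC].
have [rA rA'] := dr _ (or_introl erefl).
have [rB rB'] := dr _ (or_intror (or_introl erefl)).
have [rC rC'] := dr _ (or_intror (or_intror (or_introl erefl))).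
pose range (u : R) := [/\ `|u| <= 1 & -1 <= u < 1].
have h0 : range 0 by split; rewrite ?normr0//; lra.
have h2 : range (1 / 2) by split; rewrite ?ger0_norm; lra.
have h2' : range (- (1 / 2)) by split; rewrite ?normrN ?ger0_norm; lra.
have h9 : range (4 / 9) by split; rewrite ?ger0_norm; lra.
have h9' : range (- (4 / 9)) by split; rewrite ?normrN ?ger0_norm; lra.
have sAB : sign_at D (at_strand A (1 / 2)) (at_strand B (1 / 2)) =
    sgz (shalf A) * sgz (shalf B).
  rewrite (sign_at_drawn gD r0 A0 B0 rA rB (velocity_rising_left _ _)
    (velocity_rising_left _ _) h2.2 h2.2) [X in _ * X]gtr0_sgz ?mulr1// /det/=;
      lra.
have sAB' : sign_at D' (at_strand A (- (1 / 2))) (at_strand B (- (1 / 2))) =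
    sgz (shalf A) * sgz (shalf B).
  rewrite (sign_at_drawn gD' r0 A0 B0 rA' rB' (velocity_rising_right _ _)
    (velocity_rising_right _ _) h2'.2 h2'.2) [X in _ * X]gtr0_sgz ?mulr1//
      /det/=; lra.
have sCA : sign_at D (at_strand C (- (4 / 9))) (at_strand A 0) =
    sgz (shalf C) * sgz (shalf A).
  rewrite (sign_at_drawn gD r0 C0 A0 rC rA (velocity_horizontal _ _)
    (velocity_rising_left _ _) h9'.2 h0.2) [X in _ * X]gtr0_sgz ?mulr1//
      /det/=; lra.
have sCA' : sign_at D' (at_strand C (4 / 9)) (at_strand A 0) =
    sgz (shalf C) * sgz (shalf A).
  rewrite (sign_at_drawn gD' r0 C0 A0 rC' rA' (velocity_horizontal _ _)
    (velocity_rising_right _ _) h9.2 h0.2) [X in _ * X]gtr0_sgz ?mulr1//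
      /det/=; lra.
have sCB : sign_at D (at_strand C (4 / 9)) (at_strand B 0) =
    sgz (shalf C) * sgz (shalf B).
  rewrite (sign_at_drawn gD r0 C0 B0 rC rB (velocity_horizontal _ _)
    (velocity_rising_left _ _) h9.2 h0.2) [X in _ * X]gtr0_sgz ?mulr1// /det/=;
      lra.
have sCB' : sign_at D' (at_strand C (- (4 / 9))) (at_strand B 0) =
    sgz (shalf C) * sgz (shalf B).
  rewrite (sign_at_drawn gD' r0 C0 B0 rC' rB' (velocity_horizontal _ _)
    (velocity_rising_right _ _) h9'.2 h0.2) [X in _ * X]gtr0_sgz ?mulr1//
      /det/=; lra.
set x := mk_crossing bAB _ _ _; set y := mk_crossing b _ _ _.
set z := mk_crossing b _ _ _; set x' := mk_crossing bAB _ _ _.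
set y' := mk_crossing b _ _ _; set z' := mk_crossing b _ _ _.
have ax : seen_alike W x x'.
  apply: seen_alike_strands;
    [|exact: h2.1|exact: h2.1|exact: h2'.1|exact: h2'.1].
  by move=> p; rewrite /inside /= !negb_or => /and4P[-> ->].
have ay : seen_alike W y y'.
  apply: seen_alike_strands;
    [|exact: h9'.1|exact: h0.1|exact: h9.1|exact: h0.1].
  by move=> p; rewrite /inside /= !negb_or => /and4P[-> _ ->].
have az : seen_alike W z z'.
  apply: seen_alike_strands;
    [|exact: h9.1|exact: h0.1|exact: h9'.1|exact: h0.1].
  by move=> p; rewrite /inside /= !negb_or => /and4P[_ -> ->].
have kx : x.2 = x'.2 by rewrite /x /x'; case: (bAB).
have ky : y.2 = y'.2 by rewrite /y /y'; case: (b).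
have kyz : z.2 = y.2 by rewrite /y /z; case: (b).
have kyz' : z'.2 = y.2 by rewrite /y /z'; case: (b).
have kxy : y.2 == Classical -> x.2 == Classical.
  rewrite /x /y => /eqP e; apply/eqP; case: (bAB) => /=; apply: kv;
  by move: e; case: (b).
have sx : sgn D x = sgn D' x' by rewrite !sgn_mk_crossing sAB sAB'.
have sy : sgn D y = sgn D' y' by rewrite !sgn_mk_crossing sCA sCA'.
have sz : sgn D z = sgn D' z' by rewrite !sgn_mk_crossing sCB sCB'.
have fx : is_self x = (scomp A == scomp B).
  by rewrite /x; case: (bAB); rewrite /is_self // eq_sym.
have fy : is_self y = (scomp A == scomp C).
  by rewrite /y; case: (b); rewrite /is_self // eq_sym.
have fz : is_self z = (scomp B == scomp C).
  by rewrite /z; case: (b); rewrite /is_self // eq_sym.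
have fx' := seen_alike_self ax; have fy' := seen_alike_self ay.
have fz' := seen_alike_self az.
(* The three identities needed when all strands lie on one component. *)
have [E1 E2 E3] : [/\ sgn D y * interlacing x y + sgn D z * interlacing x z =
       sgn D' y' * interlacing x' y' + sgn D' z' * interlacing x' z',
     sgn D x * interlacing y x + sgn D z * interlacing y z =
       sgn D' x' * interlacing y' x' + sgn D' z' * interlacing y' z' &
     sgn D x * interlacing z x + sgn D y * interlacing z y =
       sgn D' x' * interlacing z' x' + sgn D' y' * interlacing z' y'].
  rewrite -sx -sy -sz !sgn_mk_crossing sAB sCA sCB.
  by apply: triangle_interlacing => //; apply/andP; split; lra.
have I1 c : signed_interlacing D [:: x; y; z] c =
    (if (x.2 == Classical) && (scomp A == scomp B)
     then sgn D x * interlacing c x else 0) +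
    ((if (y.2 == Classical) && (scomp A == scomp C)
     then sgn D y * interlacing c y else 0) +
    (if (y.2 == Classical) && (scomp B == scomp C)
     then sgn D z * interlacing c z else 0)).
  rewrite /signed_interlacing big_seq3_cond.
  by rewrite kyz fx fy fz.
have I2 c : signed_interlacing D' [:: x'; y'; z'] c =
    (if (x.2 == Classical) && (scomp A == scomp B)
     then sgn D x * interlacing c x' else 0) +
    ((if (y.2 == Classical) && (scomp A == scomp C)
     then sgn D y * interlacing c y' else 0) +
    (if (y.2 == Classical) && (scomp B == scomp C)
     then sgn D z * interlacing c z' else 0)).
  rewrite /signed_interlacing big_seq3_cond.
  by rewrite kyz' -kx -ky -fx' -fy' -fz' fx fy fz -sx -sy -sz.
split.
  move=> c oc uc; rewrite I1 I2 (seen_alike_interlacing ax oc uc).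
  by rewrite (seen_alike_interlacing ay oc uc)
    (seen_alike_interlacing az oc uc).
rewrite -sx -sy -sz in E1 E2 E3.
have [[ox ux _] [oy uy _] [oz uz _]] := And3 ax ay az.
rewrite big_seq3_cond [RHS]big_seq3_cond -kx -ky kyz kyz'.
have N1 : x.2 == Classical -> is_self x ->
    signed_interlacing D [:: x; y; z] x =
    signed_interlacing D' [:: x'; y'; z'] x'.
  rewrite I1 I2 fx => -> /eqP ->; rewrite eqxx !interlacingxx /=.
  by case: (_ && _); rewrite ?E1.
have N2 : y.2 == Classical -> is_self y ->
    signed_interlacing D [:: x; y; z] y =
    signed_interlacing D' [:: x'; y'; z'] y'.
  rewrite I1 I2 fy => yc /eqP ->; rewrite yc (kxy yc) (eq_sym (scomp C)) eqxx.
  rewrite !interlacingxx /= !mulr0 !add0r.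
  by case: (_ == _); rewrite ?E2.
have N3 : y.2 == Classical -> is_self z ->
    signed_interlacing D [:: x; y; z] z =
    signed_interlacing D' [:: x'; y'; z'] z'.
  rewrite I1 I2 fz => yc /eqP ->; rewrite yc (kxy yc) eqxx.
  rewrite !interlacingxx /= !mulr0 !addr0.
  by case: (_ == _); rewrite ?E3.
apply: (f_equal2 +%R); [|apply: (f_equal2 +%R)].
- case: ifP => [xc|_]; last exact: erefl.
  apply: (eq_interlacing_value _ _ ox ux sx) => fxx.
  by rewrite (N1 xc fxx) (seen_alike_rest D ax hr).
- case: ifP => [yc|_]; last exact: erefl.
  apply: (eq_interlacing_value _ _ oy uy sy) => fyy.
  by rewrite (N2 yc fyy) (seen_alike_rest D ay hr).
- case: ifP => [yc|_]; last exact: erefl.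
  apply: (eq_interlacing_value _ _ oz uz sz) => fzz.
  by rewrite (N3 yc fzz) (seen_alike_rest D az hr).
Qed.

End Moves23.

(** * Isotopies *)

Section Isotopy.
Context (R : realType) (n : nat).
Implicit Types (D : diagram R n) (p q : moving_point R n).
Implicit Types (cl : {set 'I_n}).

(** By the intermediate value theorem. *)
Lemma sgz_constant (h : R -> R) : continuous h ->
  (forall s, 0 <= s <= 1 -> h s <> 0) -> sgz (h 0) = sgz (h 1).
Proof.
move=> ch h0; apply/eqP/negP => /negP e.
have [||s] := @IVT R h 0 1 0 ler01.
- exact: continuous_subspaceT.
- have n0 : h 0 <> 0 by apply: h0; lra.
  have n1 : h 1 <> 0 by apply: h0; lra.
  rewrite ge_min le_max; move: e.
  by case: (sgzP (h 0)) => // a; case: (sgzP (h 1)) => // a' _; lra.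
by rewrite in_itv /= => /h0.
Qed.

Lemma floor_constant (h : R -> R) : continuous h ->
  (forall s (m : int), 0 <= s <= 1 -> h s <> m%:~R) ->
  Num.floor (h 0) = Num.floor (h 1).
Proof.
move=> ch hi; pose m := Num.floor (h 0).
have const (k : int) : sgz (h 0 - k%:~R) = sgz (h 1 - k%:~R).
  apply: (@sgz_constant (fun s => h s - k%:~R)).
    by move=> s; apply: cvgB; [exact: ch|exact: cvg_cst].
  by move=> s /(hi s k) hk /eqP; rewrite subr_eq0 => /eqP.
have /andP[m1 m2] : m%:~R <= h 0 < (m + 1)%:~R by rewrite -floor_eq.
apply/esym/eqP; rewrite floor_eq -/m.
have e1 := const m; have e2 := const (m + 1).
have n0 : h 0 <> m%:~R by apply: hi; lra.
have p0 : 0 < h 0 - m%:~R.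
  by rewrite subr_gt0 lt_neqAle m1 andbT eq_sym; apply/eqP.
have p1 : h 0 - (m + 1)%:~R < 0 by rewrite subr_lt0.
rewrite gtr0_sgz// in e1; rewrite ltr0_sgz// in e2.
apply/andP; split.
  rewrite -subr_ge0 ltW// -sgz_gt0 -e1//.
by rewrite -subr_lt0 -sgz_lt0 -e2.
Qed.

(** The algebraic number of passages through the base point; each of them
    changes by 2 the comparison with any other point of the component. *)
Definition turns cl p : int :=
  if p.1 \in cl then Num.floor (p.2 1) - Num.floor (p.2 0) else 0.

Definition point_at cl p (s : R) : point R n := normalize cl (p.1, p.2 s).

(** On a closed component, the lifts x and y of two distinct points of the
    circle never differ by an integer, so floor (y - x) is constant; and
    the order of the fractional parts is floor (y - x) - floor y + floor
    x, which is 0 or -1. *)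
Lemma order_sign_moving cl p q : p.1 = q.1 ->
  continuous p.2 -> continuous q.2 ->
  (forall s, 0 <= s <= 1 -> point_at cl p s <> point_at cl q s) ->
  order_sign (point_at cl p 1) (point_at cl q 1) =
  order_sign (point_at cl p 0) (point_at cl q 0)
  + (turns cl p - turns cl q) *+ 2.
Proof.
case: p => i x; case: q => _ y /= <- cx cy d.
rewrite /order_sign /turns /= eqxx.
have cyx : continuous (fun s => y s - x s).
  by move=> s; apply: cvgB; [exact: cy|exact: cx].
move: d; rewrite /point_at /normalize /=.
case: ifP => icl d; last first.
  rewrite subrr mul0rn addr0; apply/esym/(@sgz_constant (fun s => y s - x s))
    => //.
  by move=> s /d h /eqP; rewrite subr_eq0 => /eqP e; apply: h; rewrite e.
have fc : Num.floor (y 0 - x 0) = Num.floor (y 1 - x 1).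
  apply: (@floor_constant (fun s => y s - x s)) => // s m /d h e; apply: h.
  have -> : y s = x s + m%:~R by lra.
  by rewrite floorDrz ?intr_int// intrKfloor; congr pair; rewrite intrD; ring.
(* The two base point terms [floor y] and [floor x] are all that varies. *)
suff H s : 0 <= s <= 1 ->
    sgz (y s - (Num.floor (y s))%:~R - (x s - (Num.floor (x s))%:~R)) =
    1 + (Num.floor (y s - x s) - Num.floor (y s) + Num.floor (x s)) *+ 2.
  by rewrite !H ?lexx ?ler01// fc; ring.
move=> /d h.
set a := Num.floor (y s); set b := Num.floor (x s).
have /andP[a1 a2] : a%:~R <= y s < (a + 1)%:~R by rewrite -floor_eq.
have /andP[b1 b2] : b%:~R <= x s < (b + 1)%:~R by rewrite -floor_eq.
rewrite !intrD in a2 b2.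
case: (ltgtP (y s - a%:~R) (x s - b%:~R)) => e.
- rewrite ltr0_sgz ?subr_lt0//.
  suff -> : Num.floor (y s - x s) = a - b - 1 by ring.
  by apply/eqP; rewrite floor_eq !(intrD, intrN); apply/andP; split; lra.
- rewrite gtr0_sgz ?subr_gt0//.
  suff -> : Num.floor (y s - x s) = a - b by ring.
  by apply/eqP; rewrite floor_eq !(intrD, intrN); apply/andP; split; lra.
- by case: h; rewrite -/a -/b e.
Qed.

(** Every end of a chord occurs in [interlacing] with both signs, so the
    terms [turns] cancel: the form depends on the cyclic order only. *)
Lemma interlacing_moving cl (c x : moving_crossing R n) :
  c.1.1.1 = c.1.2.1 -> x.1.1.1 = x.1.2.1 ->
  continuous c.1.1.2 -> continuous c.1.2.2 ->
  continuous x.1.1.2 -> continuous x.1.2.2 ->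
  (forall s, 0 <= s <= 1 ->
     let y := crossing_at cl s x in let d := crossing_at cl s c in
     [&& over y != over d, over y != under d,
         under y != over d & under y != under d]) ->
  interlacing (crossing_at cl 1 c) (crossing_at cl 1 x) =
  interlacing (crossing_at cl 0 c) (crossing_at cl 0 x).
Proof.
case: c => [[p q] kc]; case: x => [[u v] kx] /= pq uv cp cq cu cv d.
case: (eqVneq p.1 u.1) => [pu|npu]; last first.
  by rewrite /interlacing /order_sign /= -pq -uv (negbTE npu).
have order a b (ab : a.1 = b.1) (ca : continuous a.2) (cb : continuous b.2)
    (h : forall s, 0 <= s <= 1 -> point_at cl b s != point_at cl a s) :
    order_sign (point_at cl a 1) (point_at cl b 1) =
    order_sign (point_at cl a 0) (point_at cl b 0)
    + (turns cl a - turns cl b) *+ 2.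
  by apply: order_sign_moving => // s /h/eqP /nesym.
rewrite /interlacing.
rewrite [order_sign (over (_ _ 1 _)) (over (_ _ 1 _))]order ?pu//; last first.
  by move=> s /d/and4P[].
rewrite [order_sign (over (_ _ 1 _)) (under (_ _ 1 _))]order -?uv ?pu//;
  last first.
  by move=> s /d/and4P[].
rewrite [order_sign (under (_ _ 1 _)) (over (_ _ 1 _))]order -?pq ?pu//;
  last first.
  by move=> s /d/and4P[].
rewrite [order_sign (under (_ _ 1 _)) (under (_ _ 1 _))]order -?pq -?uv ?pu//;
  last first.
  by move=> s /d/and4P[].
rewrite /point_at /over /under /=; ring.
Qed.

Lemma derive1_shift (h : R -> R) (a t : R) : (forall z, h (z + a) = h z) ->
  h^`()%classic (t + a) = h^`()%classic t.
Proof.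
move=> e; rewrite /derive1; set d := (fun _ : R => _);
  set d' := (fun _ : R => _).
suff -> : d = d' by [].
by rewrite funeqE => z; rewrite /d /d' addrA !e.
Qed.

Lemma periodic_int (T : Type) (h : R -> T) (m : int) :
  (forall t, h (t + 1) = h t) -> forall t, h (t + m%:~R) = h t.
Proof.
move=> h1; have pos (k : nat) t : h (t + k%:R) = h t.
  elim: k => [|k IH]; first by rewrite addr0.
  by rewrite -natr1 addrA h1.
case: m => k t; first exact: pos.
by rewrite NegzE mulrNz -[in RHS](subrK k.+1%:R t) pos.
Qed.

Lemma tangent_normalize D (i : 'I_n) (t : R) : generic D ->
  tangent D (normalize (closed D) (i, t)) = velocity (curve D i) t.
Proof.
move=> gD; rewrite /tangent /normalize /=.
case: ifP => // icl.
have pe (z : R) : curve D i (z + (- Num.floor t)%:~R) = curve D i z.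
  exact: (periodic_int _ (fun z => generic_periodic gD z icl)).
by rewrite /velocity -mulrNz; congr pair; apply: derive1_shift => z; rewrite pe.
Qed.

Lemma continuous_fst_comp (h : R -> R * R) :
  continuous h -> continuous (fun s => (h s).1).
Proof. by move=> ch s; apply: (cvg_comp _ _ (ch s)); exact: cvg_fst. Qed.

Lemma continuous_snd_comp (h : R -> R * R) :
  continuous h -> continuous (fun s => (h s).2).
Proof. by move=> ch s; apply: (cvg_comp _ _ (ch s)); exact: cvg_snd. Qed.

(** The determinant of the two tangents is computed on the continuous
    lifts of the parameters, and transversality keeps it away from 0. *)
Lemma sgn_moving cl (g : R -> 'I_n -> R -> plane R)
    (xs : seq (moving_crossing R n)) (c : moving_crossing R n) :
  let Ds s := Diagram cl (g s) (map (crossing_at cl s) xs) in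
  (forall i, continuous ((fun z => velocity (g z.1 i) z.2) : R * R -> R * R)) ->
  (forall s, 0 <= s <= 1 -> generic (Ds s)) ->
  continuous c.1.1.2 -> continuous c.1.2.2 ->
  (forall s, crossing_at cl s c \in crossings (Ds s)) ->
  sgn (Ds 0) (crossing_at cl 0 c) = sgn (Ds 1) (crossing_at cl 1 c).
Proof.
case: c => [[[i x] [j y]] k] Ds cg gD cx cy cD.
rewrite /sgn /sign_at /over /under /=.
have tE s : 0 <= s <= 1 ->
    det (tangent (Ds s) (normalize cl (i, x s)))
        (tangent (Ds s) (normalize cl (j, y s))) =
    det (velocity (g s i) (x s)) (velocity (g s j) (y s)).
  move=> s01; have gs := gD s s01.
  rewrite (@tangent_normalize (Ds s) i (x s) gs).
  by rewrite (@tangent_normalize (Ds s) j (y s) gs).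
rewrite (tE 0) ?(tE 1) ?lexx ?ler01//.
have cv i' (z : R -> R) : continuous z ->
    continuous ((fun s => velocity (g s i') (z s)) : R -> R * R).
  move=> cz s; apply: (@continuous_comp _ _ _ (fun s => (s, z s) : R * R)
    (fun w => velocity (g w.1 i') w.2 : R * R)); last exact: cg.
  exact: (cvg_pair cvg_id (cz s)).
have [ci cj] := (cv i x cx, cv j y cy).
apply: (@sgz_constant (fun s =>
  det (velocity (g s i) (x s)) (velocity (g s j) (y s)))).
  have [i1 i2] := (continuous_fst_comp ci, continuous_snd_comp ci).
  have [j1 j2] := (continuous_fst_comp cj, continuous_snd_comp cj).
  move=> s; rewrite /det; apply: cvgB; apply: cvgM;
    [exact: i1|exact: j2|exact: i2|exact: j1].
move=> s s01; rewrite -tE//.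
by have [_ _ _] := generic_sound (gD s s01) (cD s).
Qed.

Lemma nth_In (T : Type) (x0 : T) (s : seq T) k :
  (k < size s)%N -> List.In (nth x0 s k) s.
Proof.
elim: s k => // a s IH [|k] /= h; [by left|right; exact: IH].
Qed.

Context (V : zmodType) (f : 'I_n -> nat -> V) (g : 'I_n -> 'I_n -> V).

Lemma planar_isotopy_state_sum D D' :
  planar_isotopy D D' -> state_sum f g D = state_sum f g D'.
Proof.
case=> [G [xs]]; set cl := closed D; move=> [[_ cG] cx gD _].
set Ds := fun s => Diagram cl (G s) (map (crossing_at cl s) xs) in gD *.
rewrite -/(Ds 0) -/(Ds 1) => -[-> ->].
have g0 : generic (Ds 0) by apply: gD; lra.
have g1 : generic (Ds 1) by apply: gD; lra.
rewrite (state_sumE f g g0) (state_sumE f g g1).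
case: (posnP (size xs)) => [/size0nil xs0|xs_gt0].
  by rewrite [crossings (Ds 0)]/= [crossings (Ds 1)]/= xs0 !big_nil.
have c0 : moving_crossing R n by case: (xs) xs_gt0.
have cc k : (k < size xs)%N -> continuous (nth c0 xs k).1.1.2 /\
    continuous (nth c0 xs k).1.2.2.
  by move=> h; apply: cx; exact: nth_In.
have mem k s : (k < size xs)%N ->
    crossing_at cl s (nth c0 xs k) \in crossings (Ds s).
  by move=> h; rewrite /= -(nth_map c0 (crossing_at cl s c0))// mem_nth//
    size_map.
have sg k : (k < size xs)%N -> sgn (Ds 0) (crossing_at cl 0 (nth c0 xs k)) =
    sgn (Ds 1) (crossing_at cl 1 (nth c0 xs k)).
  move=> h; have [h1 h2] := cc k h.
  by apply: (sgn_moving cG gD h1 h2) => s; exact: mem.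
have il k l : (k < size xs)%N -> (l < size xs)%N ->
    is_self (crossing_at cl 0 (nth c0 xs k)) ->
    is_self (crossing_at cl 0 (nth c0 xs l)) ->
    interlacing (crossing_at cl 0 (nth c0 xs k))
      (crossing_at cl 0 (nth c0 xs l)) =
    interlacing (crossing_at cl 1 (nth c0 xs k))
      (crossing_at cl 1 (nth c0 xs l)).
  move=> kx lx /eqP sk /eqP sl; case: (eqVneq k l) => [->|kl].
    by rewrite !interlacingxx.
  have [k1 k2] := cc k kx; have [l1 l2] := cc l lx.
  apply/esym/interlacing_moving => // s s01 /=.
  have [//|/eqP e] := orP (crossing_points_distinct (gD s s01) (mem k s kx)
    (mem l s lx)).
  have := generic_uniq (gD s s01); rewrite cat_uniq => /andP[/map_uniq u _].
  have := @nth_uniq _ (crossing_at cl s c0) _ l k _ _ u.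
  rewrite !size_map => /(_ lx kx).
  by rewrite !(nth_map c0)// e eqxx eq_sym (negbTE kl).
have N k : (k < size xs)%N -> is_self (crossing_at cl 0 (nth c0 xs k)) ->
    signed_interlacing (Ds 0) (crossings (Ds 0))
      (crossing_at cl 0 (nth c0 xs k)) =
    signed_interlacing (Ds 1) (crossings (Ds 1))
      (crossing_at cl 1 (nth c0 xs k)).
  move=> kx sk; rewrite /signed_interlacing [LHS]big_map [RHS]big_map.
  rewrite (big_nth c0) [RHS](big_nth c0) big_nat_cond [RHS]big_nat_cond.
  apply: eq_bigr => l /andP[/andP[_ lx] /andP[_ sl]].
  by rewrite (sg l lx) (il k l kx lx sk sl).
rewrite [LHS]big_map [RHS]big_map.
rewrite (big_nth c0) [RHS](big_nth c0) big_nat_cond [RHS]big_nat_cond.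
apply: eq_bigr => k /andP[/andP[_ kx] _].
apply: (@eq_interlacing_value _ _ _ f g (Ds 0) (Ds 1)
  (crossing_at cl 0 (nth c0 xs k)) (crossing_at cl 1 (nth c0 xs k))).
- exact: erefl.
- exact: erefl.
- exact: sg.
- exact: N.
Qed.

Lemma same_diagram_state_sum D D' :
  same_diagram D D' -> state_sum f g D = state_sum f g D'.
Proof.
case: D => cl cv X; case: D' => cl' cv' X' [gD gD' /= e1 e2 e3].
move: cl' cv' e1 e2 gD' => _ _ <- <- gD'.
have P : perm_eq [seq c <- X | c.2 == Classical]
  [seq c <- X' | c.2 == Classical].
  apply: uniq_perm.
  - apply: filter_uniq; have := generic_uniq gD.
    by rewrite cat_uniq => /andP[/map_uniq].
  - apply: filter_uniq; have := generic_uniq gD'.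
    by rewrite cat_uniq => /andP[/map_uniq].
  move=> c; rewrite !mem_filter; case: eqP => //= ec.
  by have := e3 c; rewrite /listed ec eqxx /= !orbF.
rewrite /state_sum -big_filter -[RHS]big_filter /= (perm_big _ P) /=.
apply: eq_bigr => c _.
suff -> : intersection_index (Diagram cl cv X) c =
  intersection_index (Diagram cl cv X') c by [].
by rewrite /intersection_index -big_filter -[RHS]big_filter (perm_big _ P).
Qed.

End Isotopy.

(** * State sums as invariants of virtual tangles *)

Section Invariance.
Context (R : realType) (n : nat).
Implicit Types (D : diagram R n).

Lemma mk_crossing_kind b (p q : point R n) k : (mk_crossing b p q k).2 = k.
Proof. by case: b. Qed.

Lemma local_move_double_points D D' W X X' : local_move D D' W X X' ->
  count (fun c => c.2 == Singular) X = count (fun c => c.2 == Singular) X' ->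
  double_point_count D = double_point_count D'.
Proof.
move=> [_ [o [r [rest [_ _ _ _ [eX eX' _]]]]]] e.
by rewrite /double_point_count eX eX' !count_cat e.
Qed.

Lemma same_diagram_no_double_point D D' : same_diagram D D' ->
  double_point_count D = 0%N -> double_point_count D' = 0%N.
Proof.
move=> [_ _ _ _ e] /eqP; rewrite -leqn0 leqNgt -has_count => /hasPn h.
apply/eqP; rewrite -leqn0 leqNgt -has_count; apply/hasPn => c cD'.
have : listed (crossings D) c by rewrite e /listed cD'.
by case/orP => [/h|/andP[_ /h]].
Qed.

(** Invariance is claimed for chains of moves between diagrams without
    double points; this excludes double points from the intermediate
    diagrams. *)
Lemma tangle_step_no_double_point D D' : tangle_step D D' ->
  (double_point_count D = 0%N <-> double_point_count D' = 0%N).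
Proof.
case=> [s|[g [xs [_ _ _ _ [-> ->]]]]|[]].
- split; first exact: same_diagram_no_double_point.
  apply: same_diagram_no_double_point; case: s => gD gD' e1 e2 e3.
  by split => // c; rewrite e3.
- by rewrite /double_point_count /= !count_map.
- case=> [S [b [k [/eqP/negbTE kS lm]]]].
  rewrite (local_move_double_points lm) //=.
  by rewrite mk_crossing_kind kS.
- case=> [A [B [b [k [/eqP/negbTE kS lm]]]]].
  rewrite (local_move_double_points lm) //=.
  by rewrite !mk_crossing_kind kS.
- case=> [A [B [C [b [bAB [k [kAB [_ _ lm]]]]]]]].
  rewrite (local_move_double_points lm) //=.
  by rewrite !mk_crossing_kind.
- case=> [A [B [b lm]]].
  rewrite (local_move_double_points lm) //=.
  by rewrite !mk_crossing_kind addnCA.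
Qed.

Lemma vertex_twist_double_point D D' :
  vertex_twist D D' -> double_point_count D <> 0%N.
Proof.
case=> [A [B [b [_ [o [r [rest [_ _ _ _ [eX _ _]]]]]]]]].
by rewrite /double_point_count eX /= eqxx addnCA.
Qed.

Context (V : zmodType) (f : 'I_n -> nat -> V) (g : 'I_n -> 'I_n -> V).

Lemma tangle_equiv_state_sum D D' : (forall i, f i 0 = 0) ->
  tangle_equiv D D' -> double_point_count D = 0%N ->
  state_sum f g D = state_sum f g D'.
Proof.
move=> f0 e; pose P D D' := (double_point_count D = 0%N <->
  double_point_count D' = 0%N) /\
  (double_point_count D = 0%N -> state_sum f g D = state_sum f g D').
(* Both parts are needed together: the equality is used only once the absence
   of double points has been carried along the chain. *)
suff [] : P D D' by [].
elim: e => {D D'} [D D' st|D|D D' _ [h1 h2]|D D' D'' _ [h1 h2] _ [h3 h4]].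
- split; first exact: tangle_step_no_double_point.
  move=> d; case: st => [||[]].
  + exact: same_diagram_state_sum.
  + exact: planar_isotopy_state_sum.
  + exact: reidemeister1_state_sum.
  + exact: reidemeister2_state_sum.
  + exact: reidemeister3_state_sum.
  + by move=> t; case: (vertex_twist_double_point t d).
- by split=> [|_]; [exact: iff_refl|exact: erefl].
- by split=> [|d]; [exact: iff_sym|exact/esym/h2/h1].
- split=> [|d]; first exact: iff_trans h1 h3.
  exact: (etrans (h2 d) (h4 (h1.1 d))).
Qed.

End Invariance.

Section Resolution.
Context (R : realType) (V : nat -> zmodType).
Context (f : forall n, 'I_n -> nat -> V n) (g : forall n, 'I_n -> 'I_n -> V n).
Let nu n (D : diagram R n) := state_sum (@f n) (@g n) D.

Section Fixed.
Context (n : nat) (D : diagram R n).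
Implicit Types (c : crossing R n) (s : seq (crossing R n)).

(** The common index of [c] in all resolutions of the double points of
    [D]. *)
Definition flat_index c : int :=
  \sum_(x <- crossings D | x.2 != Virtual) index_term D c x.

Definition flat_value c : V n :=
  state_weight (@f n) (@g n) c `|flat_index c|%N *~ sgn D c.

Lemma index_term_resolution c x b :
  index_term D c (mk_crossing b (over x) (under x) Classical) =
  index_term D c x.
Proof.
case: b; first by [].
by rewrite -(index_term_flip D c x).
Qed.

(** Each resolved double point contributes the difference of its two
    [flat_value]s, which does not depend on the other double points:
    resolving a second one gives 0. The hypothesis is kept along the
    recursion because resolving a crossing does not change its
    [index_term]. *)
Lemma resolve_state_sum done todo :
  (forall c, \sum_(x <- done | x.2 == Classical) index_term D c x
             + \sum_(x <- todo | x.2 != Virtual) index_term D c x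
             = flat_index c) ->
  resolve nu D done todo =
  match count (fun c => c.2 == Singular) todo with
  | 0 => \sum_(c <- done ++ todo | c.2 == Classical) flat_value c
  | 1 => \sum_(c <- todo | c.2 == Singular)
           (flat_value (positive_resolution D c)
            - flat_value (negative_resolution D c))
  | _ => 0
  end.
Proof.
have CV : (Classical == Virtual) = false by apply/eqP.
have SV : (Singular == Virtual) = false by apply/eqP.
have pk x : (positive_resolution D x).2 = Classical.
  exact: mk_crossing_kind.
have nk x : (negative_resolution D x).2 = Classical by exact: pk.
elim: todo done => [|x todo IH] done h /=.
  rewrite cats0 /nu /state_sum /=; apply: eq_bigr => c _.
  by rewrite /flat_value -(h c) big_nil addr0.
have [xS|xS] := boolP (x.2 == Singular).
  have step y : (forall c, index_term D c y = index_term D c x) ->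
      y.2 = Classical -> forall c,
      \sum_(x <- rcons done y | x.2 == Classical) index_term D c x
      + \sum_(x <- todo | x.2 != Virtual) index_term D c x = flat_index c.
    move=> ey ky c; rewrite -(h c) -cats1 big_cat !big_cons big_nil /=.
    by rewrite ky eqxx ey (eqP xS) SV /= addr0 addrA.
  have hp := step (positive_resolution D x)
    (fun c => index_term_resolution c x _) (pk x).
  have hn : forall c,
      \sum_(x <- rcons done (negative_resolution D x) | x.2 == Classical)
        index_term D c x
      + \sum_(x <- todo | x.2 != Virtual) index_term D c x = flat_index c.
    apply: step => [c|]; last exact: nk.
    by rewrite index_term_flip index_term_resolution.
  rewrite (IH _ hp) (IH _ hn) /=.
  case E: (count _ todo) => [|m] /=.
    have t0 : forall F : crossing R n -> V n,
        \sum_(c <- todo | c.2 == Singular) F c = 0.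
      move=> F; rewrite big_hasC// has_count E//.
    rewrite big_cons xS t0 addr0 -!cats1 -!catA /= !big_cat !big_cons /= ?pk
      ?nk eqxx.
    by rewrite opprD addrACA subrr add0r opprD addrACA subrr addr0.
  case: m E => [|m] E /=; last by rewrite subrr.
  by rewrite subrr.
rewrite add0n IH.
  by rewrite cat_rcons /= big_cons (negbTE xS).
move=> c; rewrite -(h c) -cats1 big_cat !big_cons big_nil /=.
case: x xS {h} => [pq [||]] /= xS.
- by rewrite eqxx CV /= addr0 addrA.
- by rewrite eqxx /= (_ : (Virtual == Classical) = false) ?addr0//; apply/eqP.
- by rewrite eqxx in xS.
Qed.

End Fixed.
End Resolution.

(** * A long trefoil *)

Section LongTrefoil.
Context (R : realType).

(** In the coordinate t = 18 u - 9, the curve (t^3 - 49 t, t^4 - 73 t^2),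
    scaled into the square. For distinct s and t with the same image, s^2
    + st + t^2 = 49 and either s + t = 0 or s^2 + t^2 = 73; the constants
    are such that 49 and the resulting (s + t)^2 = 25, (s - t)^2 = 121 are
    squares, so that all double points are rational. The even quartic has
    the same value, its maximum, at the end points t = - 9 and t = 9. *)
Definition trefoil_curve (u : R) : plane R :=
  (1 / 2 + ((18 * u - 9) ^+ 3 - 49 * (18 * u - 9)) / 1000,
   1 - (648 - (18 * u - 9) ^+ 4 + 73 * (18 * u - 9) ^+ 2) / 8000).

Definition trefoil_point (t : R) : point R 1 := (ord0, (t + 9) / 18).

(** The three chords interlace pairwise. A plane curve forces an even
    number of chords to meet the double point; the virtual marking leaves
    one of them. *)
Definition long_trefoil : diagram R 1 :=
  Diagram finset.set0 (fun _ => trefoil_curve)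
    [:: (trefoil_point (- 7), trefoil_point 7, Singular);
        (trefoil_point (- 8), trefoil_point 3, Classical);
        (trefoil_point (- 3), trefoil_point 8, Virtual)].

Definition trefoil_velocity (u : R) : plane R :=
  (18 * (3 * (18 * u - 9) ^+ 2 - 49) / 1000,
   18 * (4 * (18 * u - 9) ^+ 3 - 146 * (18 * u - 9)) / 8000).

Lemma trefoil_has_velocity u :
  has_velocity trefoil_curve u (trefoil_velocity u).
Proof.
split; rewrite /trefoil_curve /trefoil_velocity /=.
  by apply: is_derive_eq; rewrite /GRing.scale /=; field.
by apply: is_derive_eq; rewrite /GRing.scale /=; field.
Qed.

Lemma velocity_trefoil : velocity trefoil_curve = trefoil_velocity.
Proof.
rewrite funeqE => u; have [d1 d2] := trefoil_has_velocity u.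
by rewrite /velocity !derive1E (@derive_val _ _ _ _ _ _ _ d1)
  (@derive_val _ _ _ _ _ _ _ d2) -surjective_pairing.
Qed.

Lemma trefoil_C1 : C1 trefoil_curve.
Proof.
split.
  move=> u; have [d1 d2] := trefoil_has_velocity u.
  by split; exact: ex_derive.
have smooth (h : R -> R) : (forall u, derivable h u 1) -> continuous h.
  by move=> dh u; apply: differentiable_continuous; exact/derivable1_diffP.
have c1 : continuous (fun u => (trefoil_velocity u).1).
  by apply: smooth => u; exact: ex_derive.
have c2 : continuous (fun u => (trefoil_velocity u).2).
  by apply: smooth => u; exact: ex_derive.
rewrite velocity_trefoil => u; exact: (cvg_pair (c1 u) (c2 u)).
Qed.

Lemma trefoil_tangent t :
  tangent long_trefoil (trefoil_point t) =
  (18 * (3 * t ^+ 2 - 49) / 1000, 18 * (4 * t ^+ 3 - 146 * t) / 8000).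
Proof.
rewrite /tangent /= velocity_trefoil /trefoil_velocity.
by have -> : 18 * ((t + 9) / 18) - 9 = t by field.
Qed.

Lemma trefoil_image t : image long_trefoil (trefoil_point t) =
  (1 / 2 + (t ^+ 3 - 49 * t) / 1000, 1 - (648 - t ^+ 4 + 73 * t ^+ 2) / 8000).
Proof.
rewrite /image /= /trefoil_curve.
by have -> : 18 * ((t + 9) / 18) - 9 = t by field.
Qed.

(** Everything is computed in the coordinate t. *)
Lemma trefoil_pointP (p : point R 1) : exists t, p = trefoil_point t.
Proof.
case: p => i u; exists (18 * u - 9); rewrite (ord1 i) /trefoil_point.
by congr pair; field.
Qed.

Lemma trefoil_interior t :
  in_interior long_trefoil (trefoil_point t) = (-9 < t < 9).
Proof.
rewrite /in_interior /= inE; apply/idP/idP => /andP[h1 h2]; apply/andP; split;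
  lra.
Qed.

Lemma trefoil_point_inj t t' : trefoil_point t = trefoil_point t' -> t = t'.
Proof. by case; lra. Qed.

Lemma trefoil_double_points (s t : R) : s != t ->
  s ^+ 3 - 49 * s = t ^+ 3 - 49 * t ->
  s ^+ 4 - 73 * s ^+ 2 = t ^+ 4 - 73 * t ^+ 2 ->
  [\/ (s = - 7 /\ t = 7) \/ (s = 7 /\ t = - 7),
      (s = - 8 /\ t = 3) \/ (s = 3 /\ t = - 8) |
      (s = - 3 /\ t = 8) \/ (s = 8 /\ t = - 3)].
Proof.
move=> st e1 e2; have st0 : s - t != 0 by rewrite subr_eq0.
have f1 : s ^+ 2 + s * t + t ^+ 2 = 49.
  apply: (mulfI st0); transitivity (s ^+ 3 - t ^+ 3); first by ring.
  by move: e1; lra.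
have f2 : (s + t) * (s ^+ 2 + t ^+ 2 - 73) = 0.
  apply: (mulfI st0).
  transitivity (s ^+ 4 - 73 * s ^+ 2 - (t ^+ 4 - 73 * t ^+ 2)); first by ring.
  by rewrite e2 subrr mulr0.
have sq (a b : R) : a ^+ 2 = b ^+ 2 -> a = b \/ a = - b.
  by move=> /eqP; rewrite eqf_sqr => /orP[/eqP|/eqP]; [left|right].
move/eqP: f2; rewrite mulf_eq0 => /orP[/eqP f2|/eqP f2].
  have ts : t = - s by lra.
  have /sq[] : s ^+ 2 = 7 ^+ 2.
    by move: f1; rewrite ts => f1; transitivity
      (s ^+ 2 + s * - s + (- s) ^+ 2); [ring|rewrite f1; ring].
    by move=> s7; apply: Or31; right; lra.
  by move=> s7; apply: Or31; left; lra.
have /sq[] : (s + t) ^+ 2 = 5 ^+ 2.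
- transitivity (2 * (s ^+ 2 + s * t + t ^+ 2) - (s ^+ 2 + t ^+ 2 - 73) - 73).
    by ring.
  by rewrite f1 f2; ring.
- have /sq[] : (s - t) ^+ 2 = 11 ^+ 2.
  + transitivity (- 2 * (s ^+ 2 + s * t + t ^+ 2)
      + 3 * (s ^+ 2 + t ^+ 2 - 73) + 219); first by ring.
    by rewrite f1 f2; ring.
  + by move=> h1 h2; apply: Or33; right; lra.
  + by move=> h1 h2; apply: Or33; left; lra.
- have /sq[] : (s - t) ^+ 2 = 11 ^+ 2.
  + transitivity (- 2 * (s ^+ 2 + s * t + t ^+ 2)
      + 3 * (s ^+ 2 + t ^+ 2 - 73) + 219); first by ring.
    by rewrite f1 f2; ring.
  + by move=> h1 h2; apply: Or32; right; lra.
  + by move=> h1 h2; apply: Or32; left; lra.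
Qed.

Lemma trefoil_det s t :
  det (tangent long_trefoil (trefoil_point s))
      (tangent long_trefoil (trefoil_point t)) =
  81 / (1000 * 2000) * ((3 * s ^+ 2 - 49) * (4 * t ^+ 3 - 146 * t)
    - (4 * s ^+ 3 - 146 * s) * (3 * t ^+ 2 - 49)).
Proof. by rewrite !trefoil_tangent /det /=; field. Qed.

Lemma long_trefoil_generic : generic long_trefoil.
Proof.
split.
- by move=> i; exact: trefoil_C1.
- move=> p _; have [t ->] := trefoil_pointP p;
  rewrite trefoil_tangent => -[h1 h2].
  have e1 : 3 * t ^+ 2 = 49 by lra.
  have : 12 * (18 * (4 * t ^+ 3 - 146 * t) / 8000 * 8000 / 18) = 0.
    by rewrite h2; ring.
  have -> : 12 * (18 * (4 * t ^+ 3 - 146 * t) / 8000 * 8000 / 18) =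
    (16 * (3 * t ^+ 2) - 1752) * t by field.
  rewrite e1 => h3; have t0 : t = 0 by lra.
  by move: e1; rewrite t0; lra.
- by move=> i t /=; rewrite inE.
- move=> p; have [t ->] := trefoil_pointP p.
  rewrite trefoil_interior trefoil_image => /andP[t1 t2].
  have q1 : 0 <= t ^+ 2 by exact: sqr_ge0.
  have q2 : 0 < (9 - t) * (9 + t) by apply: mulr_gt0; lra.
  have q3 : 0 < (9 - t) * (9 + t) * (8 + t ^+ 2) by apply: mulr_gt0 => //; lra.
  have q4 : 0 <= (t ^+ 2) ^+ 2 by exact: sqr_ge0.
  (* The products below bound |t (t^2 - 49)| by 9 * 49 < 500. *)
  have a1 : 0 <= (9 - t) * t ^+ 2 by apply: mulr_ge0 => //; lra.
  have a2 : 0 <= (9 + t) * t ^+ 2 by apply: mulr_ge0 => //; lra.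
  have a3 : 0 <= (9 + t) * (98 - t ^+ 2) by apply: mulr_ge0 => //; lra.
  have a4 : 0 <= (9 - t) * (98 - t ^+ 2) by apply: mulr_ge0 => //; lra.
  rewrite /in_open_square /=.
  by apply/andP; split; apply/andP; split; lra.
- move=> i _; have ends (u : R) : u = 0 \/ u = 1 ->
      on_top_or_bottom (trefoil_curve u).
    rewrite /on_top_or_bottom /trefoil_curve /=.
    case=> ->; apply/andP; (split; [by lra|]).
    - by apply/orP; right; apply/eqP; field.
    - by apply/orP; right; apply/eqP; field.
  by split; apply: ends; [left|right].
- move=> c; rewrite !inE => /or3P[] /eqP->;
    rewrite ![over _]/= ![under _]/= !trefoil_interior !trefoil_image
      trefoil_det;
    (split; [by lra|by lra|by congr pair; field|by lra]).
- move=> p q; have [s ->] := trefoil_pointP p; have [t ->] := trefoil_pointP q.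
  move=> _ _ st; rewrite !trefoil_image => -[e1 e2].
  have nst : s != t by apply/eqP => e; apply: st; rewrite e.
  have [] := trefoil_double_points nst; [lra|lra|..].
  + move=> h; exists (trefoil_point (- 7), trefoil_point 7, Singular).
      by rewrite !inE eqxx.
    by case: h => -[-> ->]; [left|right].
  + move=> h; exists (trefoil_point (- 8), trefoil_point 3, Classical).
      by rewrite !inE eqxx orbT.
    by case: h => -[-> ->]; [left|right].
  + move=> h; exists (trefoil_point (- 3), trefoil_point 8, Virtual).
      by rewrite !inE eqxx !orbT.
    by case: h => -[-> ->]; [left|right].
- rewrite /= /over /under /=.
  have ne s t : s != t -> (trefoil_point s == trefoil_point t) = false.
    by move=> st; apply/eqP => /trefoil_point_inj e; rewrite e eqxx in st.
  rewrite !inE !ne //; apply/eqP; lra.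
Qed.

End LongTrefoil.

(** * The order of a state sum *)

Section OrderOne.
Context (R : realType) (V : nat -> zmodType).
Context (f : forall n, 'I_n -> nat -> V n) (g : forall n, 'I_n -> 'I_n -> V n).
Hypothesis f0 : forall n (i : 'I_n), f i 0 = 0.
Let nu n (D : diagram R n) := state_sum (@f n) (@g n) D.

Lemma singular_extension_state_sum n (D : diagram R n) :
  singular_extension nu D =
  match double_point_count D with
  | 0 => \sum_(c <- crossings D | c.2 == Classical) flat_value f g D c
  | 1 => \sum_(c <- crossings D | c.2 == Singular)
           (flat_value f g D (positive_resolution D c)
            - flat_value f g D (negative_resolution D c))
  | _ => 0
  end.
Proof.
rewrite /singular_extension resolve_state_sum // => c.
by rewrite big_nil add0r.
Qed.

Lemma state_sum_order_le1 : vassiliev_order_le nu 1.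
Proof.
split.
  move=> n D D' _ _ d _ e; exact: tangle_equiv_state_sum (@f0 n) e d.
move=> n D _; rewrite singular_extension_state_sum.
by case: (double_point_count D) => [|[|m]].
Qed.

(** The two resolutions have opposite signs and the same index. *)
Lemma flat_value_jump n (D : diagram R n) c : is_self c ->
  det (tangent D (over c)) (tangent D (under c)) != 0 ->
  flat_value f g D (positive_resolution D c)
  - flat_value f g D (negative_resolution D c) =
  f (over c).1 `|flat_index D c|%N *+ 2.
Proof.
move=> sc d0.
have sp : is_self (positive_resolution D c).
  by rewrite /positive_resolution /mk_crossing; case: ifP => _ //;
    rewrite -is_self_flip.
have ip : flat_index D (positive_resolution D c) = flat_index D c.
  rewrite /positive_resolution /mk_crossing; case: ifP => _;
    apply: eq_bigr => x _.
    by [].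
  by rewrite -(index_term_flipl D x sc).
have op : (over (positive_resolution D c)).1 = (over c).1.
  rewrite /positive_resolution /mk_crossing; case: ifP => _ //=.
  by rewrite -(eqP sc).
have sgp : sgn D (positive_resolution D c) = 1.
  rewrite /positive_resolution /mk_crossing; case: ifP => [h|/negbT];
    rewrite /sgn /=.
    by rewrite /sign_at gtr0_sgz.
  rewrite -leNgt le_eqVlt (negbTE d0) /= => h.
  by rewrite sign_atC /sign_at ltr0_sgz.
rewrite /negative_resolution /flat_value /state_weight sgn_flip sgp
  is_self_flip sp.
have -> : flat_index D (flip (positive_resolution D c)) =
    flat_index D (positive_resolution D c).
  by apply: eq_bigr => x _; rewrite index_term_flipl.
have -> : (over (flip (positive_resolution D c))).1 = (over c).1.
  by rewrite -op (eqP sp).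
by rewrite ip op mulrNz opprK mulr2n.
Qed.

(** Only the classical crossing is counted in the index of the double
    point, and it separates the two smoothed components. *)
Lemma long_trefoil_extension :
  singular_extension nu (long_trefoil R) = f (ord0 : 'I_1) 1 *+ 2.
Proof.
pose c : crossing R 1 :=
  (trefoil_point (- 7 : R), trefoil_point (7 : R), Singular).
have CS : (Classical == Singular) = false by apply/eqP.
have VS : (Virtual == Singular) = false by apply/eqP.
have SV : (Singular == Virtual) = false by apply/eqP.
have CV : (Classical == Virtual) = false by apply/eqP.
rewrite singular_extension_state_sum /double_point_count /= !eqxx CS VS /=.
rewrite big_mkcond !big_cons big_nil /= eqxx CS VS !addr0 -/c.
have sc : is_self c by rewrite /is_self.
rewrite (flat_value_jump sc); last first.
  by rewrite trefoil_det; apply/eqP; lra.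
congr (f _ _ *+ 2).
rewrite /flat_index big_mkcond !big_cons big_nil /= SV CV eqxx /= !addr0.
rewrite index_termxx add0r /index_term.
set x := (trefoil_point (- 8), trefoil_point 3, Classical).
have -> : in_L1 c (over x) && in_L2 c (under x) = false.
  apply/negbTE; rewrite negb_and; apply/orP; left.
  rewrite /in_L1 [over x]/= [over c]/= [under c]/= gt_min lt_max /=.
  by rewrite negb_and negb_or -!leNgt; lra.
have -> : in_L1 c (under x) && in_L2 c (over x).
  rewrite /in_L1 /in_L2 [over x]/= [under x]/= [over c]/= [under c]/=.
  by rewrite gt_min !lt_max lt_min eqxx /=; lra.
rewrite /sign_at trefoil_det gtr0_sgz //; lra.
Qed.

(** Order 0 is excluded by the long trefoil alone. *)
Theorem state_sum_order_one : f (ord0 : 'I_1) 1 *+ 2 <> 0 ->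
  vassiliev_order nu 1.
Proof.
move=> f1; split; first exact: state_sum_order_le1.
move=> m'; rewrite ltnS leqn0 => /eqP-> [_ /(_ _ (long_trefoil R))].
rewrite long_trefoil_extension => h; apply/f1/h.
  exact: long_trefoil_generic.
by rewrite /double_point_count /= eqxx.
Qed.

End OrderOne.

(** * The linking number polynomials as state sums *)

Section Polynomials.
Context (R : realType).

(** The shape in which the linking number polynomials are given. *)
Lemma state_sum_components (n : nat) (V : zmodType) (f : 'I_n -> nat -> V)
    (g : 'I_n -> 'I_n -> V) (D : diagram R n) :
  state_sum f g D =
  \sum_(i < n) \sum_(c <- crossings D | self_crossing i c)
    f i `|intersection_index D c|%N *~ sgn D c +
  \sum_(i < n) \sum_(j < n | (i < j)%N)
    (g i j *~ vlk D i j + g j i *~ vlk D j i).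
Proof.
have vlkE i j : g i j *~ vlk D i j = \sum_(c <- crossings D |
    [&& c.2 == Classical, (over c).1 == i & (under c).1 == j])
    g (over c).1 (under c).1 *~ sgn D c.
  rewrite /vlk mulrz_sumr; apply: eq_bigr => c /and3P[_ /eqP-> /eqP->];
    exact: erefl.
have -> : \sum_(i < n) \sum_(j < n | (i < j)%N)
    (g i j *~ vlk D i j + g j i *~ vlk D j i) =
    \sum_(c <- crossings D | (c.2 == Classical) && ~~ is_self c)
      g (over c).1 (under c).1 *~ sgn D c.
  transitivity (\sum_(i < n) \sum_(j < n | i != j) g i j *~ vlk D i j).
    under eq_bigr do rewrite big_split /=.
    rewrite big_split /= [X in _ + X](exchange_big_dep predT) //= -big_split /=.
    apply: eq_bigr => i _.
    rewrite [RHS](bigID (fun j : 'I_n => (i < j)%N)) /=; apply: (f_equal2 +%R).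
      by apply: eq_bigl => j; rewrite neq_ltn; case: ltnP; rewrite ?andbF.
    by apply: eq_bigl => j; rewrite neq_ltn -leqNgt; case: ltngtP.
  under eq_bigr do under eq_bigr do rewrite vlkE.
  rewrite pair_big_dep /= (exchange_big_dep
    (fun c => (c.2 == Classical) && ~~ is_self c)) /=; last first.
    move=> [i j] c /= ij /and3P[-> /eqP oi /eqP uj].
    by rewrite /is_self oi uj.
  apply: eq_bigr => c /andP[cc sc].
  rewrite (big_pred1 ((over c).1, (under c).1)) // => -[i j] /=.
  rewrite cc /= xpair_eqE !(eq_sym i) !(eq_sym j) andbC.
  case: eqP => //= <-; case: eqP => //= <-; exact: sc.
have -> : \sum_(i < n) \sum_(c <- crossings D | self_crossing i c)
    f i `|intersection_index D c|%N *~ sgn D c =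
    \sum_(c <- crossings D | (c.2 == Classical) && is_self c)
      f (over c).1 `|intersection_index D c|%N *~ sgn D c.
  rewrite (exchange_big_dep (fun c => (c.2 == Classical) && is_self c)) /=.
    apply: eq_bigr => c /andP[cc sc].
    rewrite (big_pred1 (over c).1) // => i /=.
    by rewrite /self_crossing cc /= -(eqP sc) andbb eq_sym.
  move=> i c _ /and3P[-> /eqP oi /eqP ui].
  by rewrite /is_self oi ui eqxx.
rewrite /state_sum (bigID (@is_self R n)) /=.
apply: (f_equal2 +%R); apply: eq_bigr => c /andP[_ sc].
  by rewrite /state_weight sc.
by rewrite /state_weight (negbTE sc).
Qed.

Context (a b : rat).

Definition lk_self (n : nat) (i : 'I_n) (m : nat) : mpoly n rat :=
  t_ rat i ^+ m - 1.

Definition lk_link (n : nat) (i j : 'I_n) : mpoly n rat :=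
  (if (i < j)%N then a else b) *: (t_ rat i * t_ rat j).

Lemma map_lk_self (n : nat) (i : 'I_n) (m : nat) :
  map_mpoly (intr : int -> rat) (t_ int i ^+ m - 1) = lk_self i m.
Proof. by rewrite rmorphB rmorphXn rmorph1 /= map_mpolyX. Qed.

Lemma map_p_sc n (D : diagram R n) :
  map_mpoly intr (p_sc D) =
  \sum_(i < n) \sum_(c <- crossings D | self_crossing i c)
    lk_self i `|intersection_index D c|%N *~ sgn D c.
Proof.
rewrite /p_sc raddf_sum; apply: eq_bigr => i _.
rewrite raddf_sum; apply: eq_bigr => c _.
by rewrite raddfMz /= map_lk_self.
Qed.

Lemma p_lk_state_sum n (D : diagram R n) :
  p_lk a b D = state_sum (@lk_self n) (@lk_link n) D.
Proof.
rewrite state_sum_components /p_lk map_p_sc; apply: (f_equal2 +%R) => //.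
apply: eq_bigr => i _; apply: eq_bigr => j ij.
rewrite /lk_link ij ltnNge (ltnW ij) /= scalerDl [t_ rat j * _]mulrC.
by rewrite !mulrzr -!scalerMzl.
Qed.

Definition lkL_self (n : nat) (i : 'I_n) (m : nat) : {fraction (mpoly n rat)} :=
  tofrac (lk_self i m).

Definition lkL_link (n : nat) (i j : 'I_n) : {fraction (mpoly n rat)} :=
  let t k : {fraction (mpoly n rat)} := tofrac (t_ rat k) in
  let cst (x : rat) : {fraction (mpoly n rat)} := tofrac (mpolyC n x) in
  if (i < j)%N then cst a * (t i * (t j)^-1) else cst b * ((t j)^-1 * t i).

Lemma p_lkL_state_sum n (D : diagram R n) :
  p_lkL a b D = state_sum (@lkL_self n) (@lkL_link n) D.
Proof.
rewrite state_sum_components /p_lkL map_p_sc; apply: (f_equal2 +%R).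
  rewrite raddf_sum; apply: eq_bigr => i _.
  by rewrite raddf_sum; apply: eq_bigr => c _; rewrite raddfMz.
apply: eq_bigr => i _; apply: eq_bigr => j ij.
rewrite /lkL_link ij ltnNge (ltnW ij) /= !mpolyCM !tofracM.
have cint (v : int) : tofrac (mpolyC n v%:~R) = v%:~R by rewrite !rmorph_int.
rewrite !cint; ring.
Qed.

End Polynomials.

Theorem proposition3p1p2 (R : realType) (a b : rat) :
  vassiliev_order (fun (n : nat) (D : diagram R n) => p_lk a b D) 1 /\
  vassiliev_order (fun (n : nat) (D : diagram R n) => p_lkL a b D) 1.
Proof.
have two : lk_self (ord0 : 'I_1) 1 *+ 2 != 0.
  rewrite /lk_self expr1 /t_; apply/eqP => /(congr1 (mcoeff (mnm1 ord0))).
  by rewrite mcoeffMn mcoeffB mcoeffX mcoeff1 eqxx mnm1_eq0 mcoeff0.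
split.
- have -> : (fun (n : nat) (D : diagram R n) => p_lk a b D) =
      (fun n D => state_sum (@lk_self n) (@lk_link a b n) D).
    apply: functional_extensionality_dep => n; apply/funext => D.
    exact: p_lk_state_sum.
  apply: state_sum_order_one; last exact/eqP.
  by move=> n i; rewrite /lk_self expr0 subrr.
- have -> : (fun (n : nat) (D : diagram R n) => p_lkL a b D) =
      (fun n D => state_sum (@lkL_self n) (@lkL_link a b n) D).
    apply: functional_extensionality_dep => n; apply/funext => D.
    exact: p_lkL_state_sum.
  apply: state_sum_order_one.
    by move=> n i; rewrite /lkL_self /lk_self expr0 subrr tofrac0.
  by rewrite /lkL_self -raddfMn; apply/eqP; rewrite tofrac_eq0.
Qed.
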